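(* Let $\mathbb k$ be a local field, let $d\geq2$, and let $\pi:\operatorname{SL}_d(\mathbb k)\to\mathcal U(\mathcal H)$ be an infinite-dimensional irreducible strongly continuous unitary representation on a separable Hilbert space $\mathcal H$. For every $0<\varepsilon<1$, there exist $0\neq\phi\in\mathcal H$ and a countable set $\Gamma\subset\operatorname{SL}_d(\mathbb k)$ such that $$(1-\varepsilon)^2\|f\|^2\leq \sum_{\gamma\in\Gamma}|\langle f,\pi(\gamma)\phi\rangle|^2\leq (1+\varepsilon)^2\|f\|^2\qquad(f\in\mathcal H).$$ If $q:\operatorname{SL}_d(\mathbb k)\to\operatorname{SL}_d(\mathbb k)/\operatorname{pker}(\pi)$ is the quotient map, then $\Gamma$ may be chosen so that $q|_\Gamma$ is injective and $q(\Gamma)$ is left relatively separated.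
   Context: A local field is a nondiscrete locally compact field (Archimedean or non-Archimedean). $\mathcal U(\mathcal H)$ is the unitary group of the complex Hilbert space $\mathcal H$, and $\mathbb T=\{z\in\mathbb C:|z|=1\}$. The projective kernel of a unitary representation $\pi$ of $G$ is the closed normal subgroup $\operatorname{pker}(\pi)=\{g\in G:\pi(g)\in\mathbb T I_{\mathcal H}\}$. A subset $\Lambda$ of a locally compact group $Q$ is left relatively separated if for some relatively compact identity neighborhood $V\subset Q$ one has $\sup_{x\in Q}\#(\Lambda\cap xV)<\infty$. *)

(* Defs.v *)
From HB Require Import structures.
From mathcomp Require Import all_boot all_order all_algebra.
From mathcomp Require Import sesquilinear.
From mathcomp Require Import complex.
From mathcomp Require Import all_classical all_reals topology normedtype esum.

Set Implicit Arguments.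
Unset Strict Implicit.
Unset Printing Implicit Defensive.

Import Order.TTheory GRing.Theory Num.Theory.

Local Open Scope classical_set_scope.
Local Open Scope ring_scope.

HB.mixin Record TopologicalZmodule_isTopologicalField K
    & TopologicalZmodule K & GRing.Field K := {
  field_mul_continuous : continuous (fun x : K * K => x.1 * x.2) ;
  field_inv_continuous :
    forall x : K, x != 0 -> {for x, continuous (@GRing.inv K)}
}.

#[short(type="topologicalFieldType")]
HB.structure Definition TopologicalField :=
  {K of TopologicalZmodule K & GRing.Field K
      & TopologicalZmodule_isTopologicalField K}.

HB.mixin Record TopologicalField_isLocalField K & TopologicalField K := {
  local_field_hausdorff : hausdorff_space K ;
  local_field_locally_compact : locally_compact [set: K] ;
  local_field_nondiscrete : ~ (forall A : set K, open A)
}.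

#[short(type="localFieldType")]
HB.structure Definition LocalField :=
  {K of TopologicalField K & TopologicalField_isLocalField K}.

(* A type carrying both a group law and a topology; the continuity of the
   operations is not part of the structure. *)
#[short(type="preTopologicalGroupType")]
HB.structure Definition PreTopologicalGroup := {G of Topological G & Group G}.

Definition SL (K : fieldType) (d : nat) : Type := {A : 'M[K]_d | \det A == 1}.

HB.instance Definition _ (K : fieldType) d := SubChoice.on (SL K d).

Section SLGroup.
Variables (K : fieldType) (d : nat).
Implicit Types A B C : SL K d.

Fact SL_one_subproof : \det (1%:M : 'M[K]_d) == 1.
Proof. by rewrite det1. Qed.

Fact SL_mul_subproof A B : \det (val A *m val B) == 1.
Proof. by rewrite det_mulmx (eqP (valP A)) (eqP (valP B)) mulr1. Qed.

Fact SL_inv_subproof A : \det (invmx (val A)) == 1.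
Proof. by rewrite det_inv (eqP (valP A)) invr1. Qed.

Definition SL_one : SL K d := Sub 1%:M SL_one_subproof.
Definition SL_mul A B : SL K d := Sub (val A *m val B) (SL_mul_subproof A B).
Definition SL_inv A : SL K d := Sub (invmx (val A)) (SL_inv_subproof A).

Fact SL_unitmx A : val A \in unitmx.
Proof. by rewrite unitmxE (eqP (valP A)) unitr1. Qed.

Fact SL_mulA : associative SL_mul.
Proof. by move=> A B C; apply: val_inj; rewrite /= mulmxA. Qed.

Fact SL_mul1 : left_id SL_one SL_mul.
Proof. by move=> A; apply: val_inj; rewrite /= mul1mx. Qed.

Fact SL_1mul : right_id SL_one SL_mul.
Proof. by move=> A; apply: val_inj; rewrite /= mulmx1. Qed.

Fact SL_mulV : left_inverse SL_one SL_inv SL_mul.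
Proof. by move=> A; apply: val_inj; rewrite /= mulVmx ?SL_unitmx. Qed.

Fact SL_Vmul : right_inverse SL_one SL_inv SL_mul.
Proof. by move=> A; apply: val_inj; rewrite /= mulmxV ?SL_unitmx. Qed.

HB.instance Definition _ :=
  isGroup.Build (SL K d) SL_mulA SL_mul1 SL_1mul SL_mulV SL_Vmul.

End SLGroup.

(* 'M[K]_d carries the entrywise (product) topology. *)
HB.instance Definition _ (K : topologicalFieldType) d :=
  Topological.copy (SL K d) (initial_topology (val : SL K d -> 'M[K]_d)).

Record normal_subgroup (G : preTopologicalGroupType) := NormalSubgroup {
  normal_set : set G ;
  normal1 : normal_set 1%g ;
  normalM : forall x y, normal_set x -> normal_set y -> normal_set (x * y)%g ;
  normalV : forall x, normal_set x -> normal_set x^-1%g ;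
  normalJ : forall x y, normal_set x -> normal_set (y^-1 * x * y)%g
}.

Section QuotientGroup.
Variables (G : preTopologicalGroupType) (N : normal_subgroup G).
Implicit Types x y z : G.

Definition coset_rel : rel G := fun x y => `[< normal_set N (x^-1 * y)%g >].

Fact coset_rel_refl : reflexive coset_rel.
Proof. by move=> x; apply/asboolP; rewrite mulVg; exact: normal1. Qed.

Fact coset_rel_sym : symmetric coset_rel.
Proof.
by move=> x y; apply/asboolP/asboolP => /normalV; rewrite invgM invgK.
Qed.

Fact coset_rel_trans : transitive coset_rel.
Proof.
move=> y x z /asboolP xy /asboolP yz; apply/asboolP.
by have := normalM xy yz; rewrite mulgA mulgK.
Qed.

Canonical coset_equiv := EquivRel coset_rel
  coset_rel_refl coset_rel_sym coset_rel_trans.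

End QuotientGroup.

Definition quotient_group (G : preTopologicalGroupType) (N : normal_subgroup G) :
    Type :=
  quotient_topology {eq_quot coset_equiv N}%qT.

Section QuotientGroupTheory.
Local Open Scope quotient_scope.
Variables (G : preTopologicalGroupType) (N : normal_subgroup G).
Local Notation Q := {eq_quot coset_equiv N}%qT.

Definition quotient_map (x : G) : quotient_group N := \pi_Q x.

Fact quotient_map_eq x y :
  quotient_map x = quotient_map y <-> normal_set N (x^-1 * y)%g.
Proof.
split=> [/eqmodP/asboolP//|Nxy]; exact/eqmodP/asboolP.
Qed.

Fact quotient_map_repr (a : quotient_group N) :
  quotient_map (repr (a : Q)) = a.
Proof. exact: reprK. Qed.

Definition quotient_one : quotient_group N := quotient_map 1%g.
Definition quotient_mul (a b : quotient_group N) : quotient_group N :=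
  quotient_map (repr (a : Q) * repr (b : Q))%g.
Definition quotient_inv (a : quotient_group N) : quotient_group N :=
  quotient_map (repr (a : Q))^-1%g.

Fact quotient_mulE x y :
  quotient_mul (quotient_map x) (quotient_map y) = quotient_map (x * y)%g.
Proof.
apply/quotient_map_eq.
set x' := repr _; set y' := repr _.
have /quotient_map_eq Nx : quotient_map x' = quotient_map x.
  exact: quotient_map_repr.
have /quotient_map_eq Ny : quotient_map y' = quotient_map y.
  exact: quotient_map_repr.
have := normalM (normalJ y' Nx) Ny.
by rewrite invgM !mulgA mulgK.
Qed.

Fact quotient_invE x :
  quotient_inv (quotient_map x) = quotient_map x^-1%g.
Proof.
apply/quotient_map_eq; set x' := repr _.
have /esym/quotient_map_eq Nx : quotient_map x' = quotient_map x.
  exact: quotient_map_repr.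
by have := normalJ x^-1%g Nx; rewrite !invgK mulgA mulgV mul1g.
Qed.

Fact quotient_mulA : associative quotient_mul.
Proof.
move=> a b c; rewrite -(quotient_map_repr a) -(quotient_map_repr b).
by rewrite -(quotient_map_repr c) !quotient_mulE mulgA.
Qed.

Fact quotient_mul1 : left_id quotient_one quotient_mul.
Proof.
by move=> a; rewrite -(quotient_map_repr a) quotient_mulE mul1g.
Qed.

Fact quotient_1mul : right_id quotient_one quotient_mul.
Proof.
by move=> a; rewrite -(quotient_map_repr a) quotient_mulE mulg1.
Qed.

Fact quotient_mulV : left_inverse quotient_one quotient_inv quotient_mul.
Proof.
move=> a; rewrite -(quotient_map_repr a) quotient_invE quotient_mulE.
by rewrite mulVg.
Qed.

Fact quotient_Vmul : right_inverse quotient_one quotient_inv quotient_mul.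
Proof.
move=> a; rewrite -(quotient_map_repr a) quotient_invE quotient_mulE.
by rewrite mulgV.
Qed.

HB.instance Definition _ :=
  Topological.copy (quotient_group N) (quotient_topology Q).
HB.instance Definition _ := isGroup.Build (quotient_group N)
  quotient_mulA quotient_mul1 quotient_1mul quotient_mulV quotient_Vmul.

End QuotientGroupTheory.

(* [card_le S `I_n] says that S has at most n elements. *)
Definition left_relatively_separated (Q : preTopologicalGroupType)
    (L : set Q) : Prop :=
  exists V : set Q, [/\ nbhs 1%g V, precompact V &
    exists n : nat, forall x : Q,
      (L `&` [set (x * v)%g | v in V] #<= `I_n)%card].

(* [inner] is linear in its first argument. *)

HB.mixin Record CompleteNormedModule_isHilbert (R : realType) H
    & CompleteNormedModule R[i] H := {
  inner : {dot H for (@Num.conj R[i])} ;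
  inner_norm : forall x : H, `|x| ^+ 2 = inner x x
}.

#[short(type="hilbertType")]
HB.structure Definition Hilbert (R : realType) :=
  {H of CompleteNormedModule R[i] H & CompleteNormedModule_isHilbert R H}.

(* The library's norm on modules over R[i] takes its values in R[i]. *)
Definition rnorm (R : realType) (V : normedZmodType R[i]) (x : V) : R :=
  complex.Re `|x|.

Definition separable (T : topologicalType) : Prop :=
  exists2 D : set T, countable D & dense D.

Definition infinite_dimensional (F : fieldType) (V : lmodType F) : Prop :=
  ~ exists (n : nat) (e : 'I_n -> V),
      forall v : V, exists c : 'I_n -> F, v = \sum_(i < n) c i *: e i.

Definition unitary (R : realType) (H : hilbertType R) (U : H -> H) : Prop :=
  [/\ linear U, forall x y : H, inner (U x) (U y) = inner x y
    & forall y : H, exists x : H, U x = y].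

Record unitary_rep (G : preTopologicalGroupType) (R : realType)
    (H : hilbertType R) :=
  UnitaryRep {
    urep :> G -> H -> H ;
    urep_unitary : forall g, unitary (urep g) ;
    urepM : forall g h x, urep (g * h)%g x = urep g (urep h x)
  }.

Definition strongly_continuous (G : preTopologicalGroupType) (R : realType)
    (H : hilbertType R) (rho : unitary_rep G H) : Prop :=
  forall x : H, continuous (fun g : G => rho g x).

Definition irreducible (G : preTopologicalGroupType) (R : realType)
    (H : hilbertType R)
    (rho : unitary_rep G H) : Prop :=
  (exists x : H, x != 0) /\
  forall M : set H, closed M -> M 0 ->
    (forall (a : R[i]) (x y : H), M x -> M y -> M (a *: x + y)) ->
    (forall (g : G) (x : H), M x -> M (rho g x)) ->
    M = [set 0] \/ M = setT.

Section ProjectiveKernel.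
Variables (G : preTopologicalGroupType) (R : realType) (H : hilbertType R).
Variable rho : unitary_rep G H.

Definition pker_set : set G :=
  [set g | exists2 z : R[i], `|z| = 1 & forall x : H, rho g x = z *: x].

Fact urepZ g (a : R[i]) x : rho g (a *: x) = a *: rho g x.
Proof.
have [lin _ _] := urep_unitary rho g.
have lin0 : rho g 0 = 0.
  by have := lin (-1) 0 0; rewrite scaler0 addr0 scaleN1r addNr.
by have := lin a x 0; rewrite !addr0 lin0 addr0.
Qed.

Fact urep1 x : rho 1%g x = x.
Proof.
have [_ _ /(_ x)[y <-]] := urep_unitary rho 1%g.
by rewrite -urepM mulg1.
Qed.

Fact pker1 : pker_set 1%g.
Proof. by exists 1 => [|x]; rewrite ?normr1// urep1 scale1r. Qed.

Fact pkerM g h : pker_set g -> pker_set h -> pker_set (g * h)%g.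
Proof.
move=> [z z1 gz] [w w1 hw]; exists (z * w) => [|x].
  by rewrite normrM z1 w1 mulr1.
by rewrite urepM hw gz scalerA.
Qed.

Fact pkerV g : pker_set g -> pker_set g^-1%g.
Proof.
move=> [z z1 gz]; exists z^-1 => [|x]; first by rewrite normfV z1 invr1.
have z0 : z != 0 by rewrite -normr_eq0 z1 oner_eq0.
by rewrite -[in LHS](scalerKV z0 x) -gz -urepM mulVg urep1.
Qed.

Fact pkerJ g h : pker_set g -> pker_set (h^-1 * g * h)%g.
Proof.
move=> [z z1 gz]; exists z => // x.
by rewrite !urepM gz urepZ -urepM mulVg urep1.
Qed.

Definition pker : normal_subgroup G := NormalSubgroup pker1 pkerM pkerV pkerJ.

End ProjectiveKernel.

(* Main.v *)
(** Let [u(b)] and [D(c) = diag(c, 1/c)] denote the elements of a root subgroup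
    [SL_2] of [SL_d].  A vector fixed by all [u(b)] is fixed by [D(c)] (Mautner),
    hence by all transvections, hence by [SL_d]; so there is none but [0].  It
    follows that the coefficients of [D(c)] (as [c -> 0]) and of [u(b)] (as
    [b -> oo]) tend to [0].

    Let [e_n] be a Parseval system of [H].  With [N_n] points [k_i = u(b_i)] so
    close to the identity that [rho(k_i) e_n] is almost [e_n], and with
    [h_n = D(c)], take [phi = sum_n N_n^(-1/2) rho(h_n)^-1 e_n] and let [Gamma]
    consist of the elements [k_i h_n].  Then [rho(k_i h_n) phi] is the sum of a
    vector close to [N_n^(-1/2) e_n] (whence the frame bounds, as there are [N_n]
    such vectors), of the image of the earlier terms of [phi], and of a
    negligible tail.  Since conjugation by [h_n^-1] expands [u(b)], for [c]
    close to [0] the elements [k_i h_n] are spread out so far that the images of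
    the earlier terms are almost orthogonal to each other, hence form a Bessel
    system with a small bound.  The same decay, applied to a fixed vector [psi],
    separates the points of [Gamma] modulo the projective kernel. *)

Require Import Defs.
From mathcomp Require Import all_boot all_order all_algebra.
From mathcomp Require Import complex sesquilinear ring lra.
From mathcomp Require Import all_classical all_reals topology normedtype esum.

Set Implicit Arguments.
Unset Strict Implicit.
Unset Printing Implicit Defensive.

Import Order.TTheory GRing.Theory Num.Theory.

Local Open Scope classical_set_scope.
Local Open Scope ring_scope.
Local Open Scope complex_scope.

(** * Hilbert spaces *)

(** Coefficients of [rho] are only known to tend to zero, with no rate and no integrability, so
    there is no continuous frame to sample. Instead, each [e_n] is replaced by [N_n] copies of
    [N_n^(-1/2) e_n], which together carry exactly its energy. The two errors are of different
    nature. The tail of [phi] is chosen after the block, so it can be made small against the number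
    of elements already present, and its images are square summable. The images of the earlier terms
    have norms that do not decrease with [n]; almost orthogonality makes their Bessel bound depend
    on the largest norm, at most [eta], and not on how many there are. This explains the shape
    [u(b_i) D(c)]: the factor [u(b_i)] has to stay near the identity on [e_n], while [D(c)], which
    [rho(h_n)^-1] cancels on that term, is free to drive the elements apart. The field is given by
    its topology alone, without an absolute value, so [b -> oo] is written [b = 1/t] with
    [t -> 0]. *)

Section RealNorm.
Variable R : realType.

Lemma normr_rnorm (V : normedZmodType R[i]) (x : V) : `|x| = (rnorm x)%:C.
Proof. by rewrite /rnorm RRe_real// normr_real. Qed.

Lemma rnorm_ge0 (V : normedZmodType R[i]) (x : V) : 0 <= rnorm x.
Proof. by rewrite -ler0c -normr_rnorm normr_ge0. Qed.

Lemma rnorm_eq0 (V : normedZmodType R[i]) (x : V) : (rnorm x == 0) = (x == 0).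
Proof. by rewrite -[in RHS]normr_eq0 normr_rnorm (inj_eq (@complexI R) _ 0). Qed.

Lemma rnorm0 (V : normedZmodType R[i]) : rnorm (0 : V) = 0.
Proof. by apply/eqP; rewrite rnorm_eq0. Qed.

Lemma rnorm_gt0 (V : normedZmodType R[i]) (x : V) : (0 < rnorm x) = (x != 0).
Proof. by rewrite lt_def rnorm_ge0 andbT rnorm_eq0. Qed.

Lemma ler_rnormD (V : normedZmodType R[i]) (x y : V) :
  rnorm (x + y) <= rnorm x + rnorm y.
Proof. by rewrite -lecR rmorphD/= -!normr_rnorm ler_normD. Qed.

Lemma rnormN (V : normedZmodType R[i]) (x : V) : rnorm (- x) = rnorm x.
Proof. by rewrite /rnorm normrN. Qed.

Lemma rdistrC (V : normedZmodType R[i]) (x y : V) :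
  rnorm (x - y) = rnorm (y - x).
Proof. by rewrite -rnormN opprB. Qed.

Lemma ler_rnormB (V : normedZmodType R[i]) (x y : V) :
  rnorm x - rnorm y <= rnorm (x - y).
Proof. by rewrite lerBlDr; have := ler_rnormD (x - y) y; rewrite subrK. Qed.

Lemma ler_rnorm_sum (V : normedZmodType R[i]) I (r : seq I) (F : I -> V) :
  rnorm (\sum_(i <- r) F i) <= \sum_(i <- r) rnorm (F i).
Proof.
elim/big_rec2: _ => [|i y x _ le_xy]; first by rewrite rnorm0.
by apply: le_trans (ler_rnormD _ _) _; rewrite lerD2l.
Qed.

Lemma rnormM (a b : R[i]) : rnorm (a * b) = rnorm a * rnorm b.
Proof. by apply: complexI; rewrite rmorphM/= -!normr_rnorm normrM. Qed.

Lemma rnorm_real (a : R) : rnorm a%:C = `|a|.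
Proof. by rewrite /rnorm normc_def/= expr0n addr0 sqrtr_sqr. Qed.

Lemma ler_Re_rnorm (a : R[i]) : complex.Re a <= rnorm a.
Proof.
apply: le_trans (ler_norm _) _.
by rewrite -lecR -normr_rnorm normc_ge_Re.
Qed.

Lemma rnormZ (H : normedModType R[i]) (a : R[i]) (x : H) :
  rnorm (a *: x) = rnorm a * rnorm x.
Proof. by apply: complexI; rewrite rmorphM/= -!normr_rnorm normrZ. Qed.

Lemma nbhs_rnormP (H : normedModType R[i]) (x : H) (A : set H) :
  nbhs x A <-> exists2 e : R, 0 < e & forall y, rnorm (x - y) < e -> A y.
Proof.
split=> [/nbhs_normP[e /= e0 eA]|[e e0 eA]].
  have re : e = (complex.Re e)%:C by rewrite RRe_real// gtr0_real.
  exists (complex.Re e) => [|y xy]; first by rewrite -ltcR -re.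
  by apply: eA; rewrite /= re normr_rnorm ltcR.
apply/nbhs_normP; exists e%:C => /=; first by rewrite ltcR.
by move=> y /=; rewrite normr_rnorm ltcR; exact: eA.
Qed.

Lemma cvg_rnormP (H : normedModType R[i]) (T : Type) (F : set_system T)
    (f : T -> H) (l : H) : Filter F ->
  f x @[x --> F] --> l <->
  forall e : R, 0 < e -> \forall x \near F, rnorm (l - f x) < e.
Proof.
move=> FF; split=> [fl e e0|fl A /nbhs_rnormP[e e0 eA]].
  by have := fl [set y | rnorm (l - y) < e]; apply; apply/nbhs_rnormP; exists e.
by apply: filterS (fl e e0) => x; exact: eA.
Qed.

End RealNorm.

Section Hilbert.
Variables (R : realType) (H : hilbertType R).
Implicit Types x y z : H.

Lemma innerC x y : inner x y = (inner y x)^*.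
Proof. by rewrite (hermC (@inner R H) x y) expr0 mul1r. Qed.

Lemma innerDl x y z : inner (x + y) z = inner x z + inner y z.
Proof. exact: linearDl. Qed.

Lemma innerDr x y z : inner x (y + z) = inner x y + inner x z.
Proof. exact: linearDr. Qed.

Lemma innerBl x y z : inner (x - y) z = inner x z - inner y z.
Proof. exact: linearBl. Qed.

Lemma innerBr x y z : inner x (y - z) = inner x y - inner x z.
Proof. exact: linearBr. Qed.

Lemma inner0l x : inner 0 x = 0.
Proof. exact: linear0l. Qed.

Lemma inner0r x : inner x 0 = 0.
Proof. exact: linear0r. Qed.

Lemma innerZl a x y : inner (a *: x) y = a * inner x y.
Proof. exact: linearZl_LR. Qed.

Lemma innerZr a x y : inner x (a *: y) = a^* * inner x y.
Proof. exact: linearZr_LR. Qed.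

Lemma rnorm_innerZr a x y : rnorm (inner x (a *: y)) = rnorm a * rnorm (inner x
  y).
Proof. by rewrite innerZr rnormM [rnorm a^*]/rnorm normcJ. Qed.

Lemma innerZr_real (a : R) x y : inner x (a%:C *: y) = a%:C * inner x y.
Proof. by rewrite innerZr; congr (_ * _); exact: conjc_real. Qed.

Lemma inner_suml I (r : seq I) (F : I -> H) y :
  inner (\sum_(i <- r) F i) y = \sum_(i <- r) inner (F i) y.
Proof.
elim: r => [|i r IH]; first by rewrite !big_nil inner0l.
by rewrite !big_cons innerDl IH.
Qed.

Lemma inner_sumr I (r : seq I) (F : I -> H) y :
  inner y (\sum_(i <- r) F i) = \sum_(i <- r) inner y (F i).
Proof.
elim: r => [|i r IH]; first by rewrite !big_nil inner0r.
by rewrite !big_cons innerDr IH.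
Qed.

Lemma innerxx x : inner x x = (rnorm x ^+ 2)%:C.
Proof. by rewrite -inner_norm normr_rnorm rmorphXn. Qed.

Lemma rnorm_innerC x y : rnorm (inner x y) = rnorm (inner y x).
Proof. by rewrite /rnorm innerC normcJ. Qed.

Lemma rnorm_sqrD x y :
  rnorm (x + y) ^+ 2 =
  rnorm x ^+ 2 + complex.Re (inner x y) *+ 2 + rnorm y ^+ 2.
Proof.
apply: complexI; rewrite -innerxx innerDl !innerDr (innerC y x) !innerxx.
case: (inner x y) => a b; rewrite mulr2n; simpc; congr (_ +i* _) => /=; ring.
Qed.

Lemma rnorm_sqrB x y :
  rnorm (x - y) ^+ 2 =
  rnorm x ^+ 2 - complex.Re (inner x y) *+ 2 + rnorm y ^+ 2.
Proof.
rewrite rnorm_sqrD rnormN -[in LHS]scaleN1r innerZr.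
case: (inner x y) => a b; simpc => /=; ring.
Qed.

Lemma parallelogram x y :
  rnorm (x + y) ^+ 2 + rnorm (x - y) ^+ 2 =
  (rnorm x ^+ 2 + rnorm y ^+ 2) *+ 2.
Proof. by rewrite rnorm_sqrD rnorm_sqrB; ring. Qed.

(* Rotating [x] by a phase reduces to the real part, which the triangle
   inequality controls. *)
Lemma cauchy_schwarz x y : rnorm (inner x y) <= rnorm x * rnorm y.
Proof.
have reCS (u v : H) : complex.Re (inner u v) <= rnorm u * rnorm v.
  have := ler_rnormD u v; have := rnorm_sqrD u v.
  have := rnorm_ge0 u; have := rnorm_ge0 v; have := rnorm_ge0 (u + v).
  nra.
have [->|xy0] := eqVneq (inner x y) 0.
  by rewrite rnorm0 mulr_ge0 ?rnorm_ge0.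
have n0 : rnorm (inner x y) != 0 by rewrite rnorm_eq0.
pose u := (inner x y)^* / (rnorm (inner x y))%:C.
have ux : u * inner x y = (rnorm (inner x y))%:C.
  rewrite /u mulrAC (mulrC _^*) -sqr_normc normr_rnorm expr2 mulfK//.
  by rewrite (inj_eq (@complexI R) _ 0).
have u1 : rnorm u = 1.
  apply: (mulIf n0); rewrite -rnormM ux rnorm_real mul1r.
  by rewrite ger0_norm// rnorm_ge0.
by have := reCS (u *: x) y; rewrite innerZl ux/= rnormZ u1 mul1r.
Qed.

End Hilbert.

(** * Elementary matrices *)

Lemma mulgLR_solve (G : groupType) (x y l l' : G) :
  (l' * l = 1 -> l * l' = 1 -> l' * x * l' = y -> x = l * y * l)%g.
Proof. by move=> l'l ll' <-; rewrite !mulgA ll' mul1g -mulgA l'l mulg1. Qed.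

Section PlaneMatrices.
Variables (K : fieldType) (d : nat) (i j : 'I_d).
Hypothesis ij : i != j.

Definition plane_mx (a b c e : K) : 'M[K]_d :=
  a *: delta_mx i i + b *: delta_mx i j + c *: delta_mx j i + e *: delta_mx j j.

(* The matrix [[a, b], [c, e]] acting on the coordinates [i], [j]. *)
Definition emb_mx (a b c e : K) : 'M[K]_d :=
  plane_mx a b c e + (1%:M - plane_mx 1 0 0 1).

Lemma plane_mxM a b c e a' b' c' e' :
  plane_mx a b c e *m plane_mx a' b' c' e' =
  plane_mx (a * a' + b * c') (a * b' + b * e')
           (c * a' + e * c') (c * b' + e * e').
Proof.
have ji : (j == i) = false by rewrite eq_sym (negPf ij).
rewrite /plane_mx !(mulmxDl, mulmxDr) -!scalemxAl -!scalemxAr.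
rewrite !mul_delta_mx_cond !eqxx (negPf ij) ji !mulr1n !mulr0n !scaler0.
by apply/matrixP => k l; rewrite !mxE; ring.
Qed.

Lemma emb_mxM a b c e a' b' c' e' :
  emb_mx a b c e *m emb_mx a' b' c' e' =
  emb_mx (a * a' + b * c') (a * b' + b * e')
         (c * a' + e * c') (c * b' + e * e').
Proof.
have idem (P P' Q : 'M[K]_d) : P *m Q = P -> Q *m P' = P' -> Q *m Q = Q ->
    (P + (1%:M - Q)) *m (P' + (1%:M - Q)) = P *m P' + (1%:M - Q).
  move=> PQ QP' QQ.
  rewrite !(mulmxDl, mulmxDr, mulNmx, mulmxN, mulmx1, mul1mx) PQ QP' QQ.
  by move: (P *m P') => PP'; apply/matrixP => k l; rewrite !mxE; ring.
rewrite /emb_mx idem ?plane_mxM//.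
all: by rewrite ?(mulr0, mulr1, mul0r, mul1r, addr0, add0r).
Qed.

Lemma det_emb_upper b : \det (emb_mx 1 b 0 1) = 1.
Proof.
have entry k l : emb_mx 1 b 0 1 k l = (k == l)%:R + b * ((k == i) && (l == j))%:R.
  by rewrite /emb_mx /plane_mx !mxE; ring.
have ne k l : k != l -> emb_mx 1 b 0 1 k l != 0 -> k = i /\ l = j.
  rewrite entry => /negPf->; rewrite add0r.
  have [->|_] := eqVneq k i; have [->|_] := eqVneq l j => //=;
    by rewrite mulr0 eqxx.
have diag k : emb_mx 1 b 0 1 k k = 1.
  rewrite entry eqxx; case: (k =P i) => [->|_]; last by rewrite mulr0 addr0.
  by rewrite (negPf ij) mulr0 addr0.
have [ltij|leji] := ltnP i j.
  rewrite -det_tr det_trig; first by apply: big1 => k _; rewrite mxE diag.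
  apply/is_trig_mxP => k l kl; rewrite mxE; apply/eqP/negPn/negP => /ne.
  case; first by rewrite neq_ltn kl orbT.
  by move=> li kj; move: ltij kl; rewrite -li -kj => /ltnW;
    rewrite leqNgt => /negP.
rewrite det_trig; first by apply: big1 => k _; rewrite diag.
apply/is_trig_mxP => k l kl; apply/eqP/negPn/negP => /ne.
case; first by rewrite neq_ltn kl.
by move=> ki lj; move: leji kl; rewrite -ki -lj leqNgt => /negP.
Qed.

End PlaneMatrices.

Lemma emb_mx_eq (K : fieldType) d (i j : 'I_d) (a b c e a' b' c' e' : K) :
  a = a' -> b = b' -> c = c' -> e = e' ->
  emb_mx i j a b c e = emb_mx i j a' b' c' e'.
Proof. by move=> -> -> -> ->. Qed.

Section EmbeddedMatrices.
Variables (K : fieldType) (d : nat).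
Implicit Types (i j : 'I_d) (b s : K).

Definition coef i j s : 'rV[K]_d :=
  \row_k (if k == i then s else if k == j then s^-1 else 1).

Lemma emb_transv i j b : i != j -> emb_mx i j 1 b 0 1 = 1%:M + b *: delta_mx i j.
Proof. by move=> ij; apply/matrixP=> k l; rewrite /emb_mx /plane_mx !mxE;
  ring. Qed.

Lemma emb_transvC i j b : i != j -> emb_mx i j 1 0 b 1 = 1%:M + b *: delta_mx j i.
Proof. by move=> ij; apply/matrixP=> k l; rewrite /emb_mx /plane_mx !mxE;
  ring. Qed.

Lemma emb_torus i j s : i != j -> emb_mx i j s 0 0 s^-1 = diag_mx (coef i j s).
Proof.
move=> ij; apply/matrixP=> k l; rewrite /emb_mx /plane_mx !mxE.
have [<-{l}|kl] := eqVneq k l.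
  have [->|ki] := eqVneq k i; first by rewrite (negPf ij) /=; ring.
  by have [_|_] := eqVneq k j; rewrite /=; ring.
have [ki|_] := eqVneq k i; have [kj|_] := eqVneq k j.
- by rewrite -ki -kj eqxx in ij.
- by rewrite -ki eq_sym (negPf kl) /=; ring.
- by rewrite -kj [l == k]eq_sym (negPf kl) /=; ring.
by rewrite /=; ring.
Qed.

End EmbeddedMatrices.

Local Opaque emb_mx.

Section Transvections.
Variables (K : fieldType) (d : nat).
Implicit Types (i j k l : 'I_d) (a b s t : K).

(* [transv i i b] and [torus i i s], as well as [torus i j 0], are junk values,
   equal to [1%g]. *)
Definition transv i j b : SL K d := insubd (SL_one K d) (1%:M + b *: delta_mx i
  j).

Definition torus i j s : SL K d := insubd (SL_one K d) (diag_mx (coef i j s)).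

Lemma val_transv i j b : i != j -> val (transv i j b) = 1%:M + b *: delta_mx i j.
Proof.
by move=> ij; rewrite /transv val_insubd -emb_transv// det_emb_upper// eqxx.
Qed.

Lemma transvD i j a b : i != j ->
  (transv i j a * transv i j b)%g = transv i j (a + b).
Proof.
move=> ij; apply: val_inj; rewrite /= !val_transv// -!emb_transv// (emb_mxM ij).
by apply: emb_mx_eq; ring.
Qed.

Lemma transv0 i j : transv i j 0 = 1%g.
Proof.
by apply: val_inj; rewrite val_insubd scale0r addr0 det1 eqxx.
Qed.

Lemma transvV i j b : i != j -> ((transv i j b)^-1)%g = transv i j (- b).
Proof.
move=> ij; apply: (mulgI (transv i j b)).
by rewrite mulgV transvD// subrr transv0.
Qed.

(** Both sides are [[[0, s], [-1/s, 0]]]. This expresses [D(s)] through transvections, which gives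
    its determinant and, solved for the middle factor, [weyl_transv]. *)
Lemma weyl_mx i j s : i != j -> s != 0 ->
  emb_mx i j 1 0 (- s^-1) 1 *m emb_mx i j 1 s 0 1 *m emb_mx i j 1 0 (- s^-1) 1
  = emb_mx i j s 0 0 s^-1 *m
   (emb_mx i j 1 0 (-1) 1 *m emb_mx i j 1 1 0 1 *m emb_mx i j 1 0 (-1) 1).
Proof. by move=> ij s0; rewrite !(emb_mxM ij); apply: emb_mx_eq; field. Qed.

Lemma val_torus i j s : i != j -> s != 0 ->
  val (torus i j s) = diag_mx (coef i j s).
Proof.
move=> ij s0; rewrite /torus val_insubd; case: eqP => // -[].
have ji : j != i by rewrite eq_sym.
have low b : \det (emb_mx i j 1 0 b 1) = 1.
  by rewrite emb_transvC// -emb_transv// det_emb_upper.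
have := congr1 determinant (weyl_mx ij s0).
rewrite !det_mulmx (low (- s^-1)) (low (-1)) (det_emb_upper ij s).
by rewrite (det_emb_upper ij 1) (emb_torus _ ij) !mulr1 => /esym.
Qed.

(** Suited to large [s]: the outer factors then tend to the identity, so the coefficients of
    [transv i j s] decay because those of [D(s)] do. *)
Lemma weyl_transv i j s : i != j -> s != 0 ->
  transv i j s = (transv j i s^-1 * (torus i j s *
    (transv j i (-1) * transv i j 1 * transv j i (-1))) * transv j i s^-1)%g.
Proof.
move=> ij s0; have ji : j != i by rewrite eq_sym.
have := transvD (- s^-1) s^-1 ji; rewrite addNr transv0 => l'l.
have := transvD s^-1 (- s^-1) ji; rewrite subrr transv0 => ll'.
apply: (mulgLR_solve l'l ll'); apply: val_inj => /=;
  rewrite val_torus// !val_transv//.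
by rewrite -!(emb_transvC _ ij) -!(emb_transv _ ij) -emb_torus//;
  have := weyl_mx ij s0; rewrite -!mulmxA.
Qed.

(* Degenerating [t -> 0], the right-hand side tends to [D(s)]. *)
Lemma transv_torus i j s t : i != j -> s != 0 -> t != 0 ->
  (transv i j ((s - 1) / t) * transv j i t * transv i j (- ((s - 1) / (t * s))))%g
  = (torus i j s * transv j i (t * s))%g.
Proof.
move=> ij s0 t0; have ji : j != i by rewrite eq_sym.
apply: val_inj => /=; rewrite val_torus// !val_transv//.
rewrite -!(emb_transvC _ ij) -!(emb_transv _ ij) -emb_torus// !(emb_mxM ij).
by apply: emb_mx_eq; field; rewrite ?s0 ?t0.
Qed.

Lemma torus_inv i j s : i != j -> s != 0 -> torus i j s^-1 = torus j i s.
Proof.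
move=> ij s0; apply: val_inj; rewrite !val_torus ?invr_eq0// 1?eq_sym//.
congr diag_mx; apply/rowP => k; rewrite !mxE.
have [->|ki] := eqVneq k i; first by rewrite (negPf ij).
by rewrite invrK.
Qed.

Lemma transv_torusJ i j k l s b : i != j -> k != l -> s != 0 ->
  (transv k l b * torus i j s)%g =
  (torus i j s * transv k l ((coef i j s 0 k)^-1 * b * coef i j s 0 l))%g.
Proof.
move=> ij kl s0; apply: val_inj => /=; rewrite !val_transv// val_torus//.
rewrite mulmxDl mulmxDr mul1mx mulmx1 -scalemxAl -scalemxAr; congr (_ + _).
have c0 : coef i j s 0 k != 0.
  by rewrite mxE; case: ifP; rewrite ?s0//; case: ifP;
    rewrite ?invr_eq0 ?oner_eq0.
move: (coef i j s) c0 => c c0; apply/matrixP => p q.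
rewrite mul_mx_diag mul_diag_mx !mxE.
have [->|pk] := eqVneq p k; last by rewrite /= !mulr0 ?mul0r ?mulr0.
have [->|ql] := eqVneq q l; last by rewrite /= !mulr0 ?mul0r ?mulr0.
by rewrite /= mul1r !mulr1; field.
Qed.

(** Serves to reach the root subgroups that commute with a given torus, from those that the torus
    contracts or expands. *)
Lemma transv_comm i j k a b : i != j -> j != k -> i != k ->
  transv i k (a * b) =
  (transv i j a * transv j k b * (transv i j a)^-1 * (transv j k b)^-1)%g.
Proof.
move=> ij jk ik; rewrite !transvV//.
have ki : (k == i) = false by rewrite eq_sym (negPf ik).
have kj : (k == j) = false by rewrite eq_sym (negPf jk).
have ji : (j == i) = false by rewrite eq_sym (negPf ij).
apply: val_inj => /=; rewrite !val_transv//.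
rewrite !(mulmxDl, mulmxDr) !(mul1mx, mulmx1) -!scalemxAl -!scalemxAr.
rewrite !(mul_delta_mx_cond, mul1mx, mulmx1, mulmxDl, mulmxDr, =^~scalemxAl,
  =^~scalemxAr).
rewrite !eqxx ?ki ?kj ?ji !(mulr1n, mulr0n, scaler0, mul0mx, addr0,
  mul_delta_mx_cond).
rewrite ?eqxx ?ki ?kj ?ji !(mulr1n, mulr0n, scaler0, mul0mx, addr0).
by apply/matrixP => p q; rewrite !mxE; ring.
Qed.

End Transvections.

(** * Generation by transvections *)

Section Generation.
Variable K : fieldType.

Definition elem_mx n (i j : 'I_n) (b : K) : 'M[K]_n := 1%:M + b *: delta_mx i j.

(** Stated backwards, from the reduced matrix to the original one, so that each elimination step is
    one [apply]. *)
Definition elem_closed n (S : 'M[K]_n -> Prop) :=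
  forall (i j : 'I_n) b A, i != j -> S (elem_mx i j b *m A) -> S A.

(** Turns column operations into row operations. *)
Definition tr_pred n (S : 'M[K]_n -> Prop) : 'M[K]_n -> Prop := fun A => S A^T.

Lemma elem_mx_mulE n (i j k l : 'I_n) b (A : 'M[K]_n) :
  (elem_mx i j b *m A) k l = A k l + (k == i)%:R * (b * A j l).
Proof.
rewrite mulmxDl mul1mx -scalemxAl !mxE; congr (_ + _).
rewrite (bigD1 j)//= big1 ?addr0 => [|m mj]; rewrite !mxE.
  by rewrite eqxx andbT; ring.
by rewrite (negPf mj) andbF mul0r.
Qed.

Lemma tr_elem_mx n (i j : 'I_n) b : (elem_mx i j b)^T = elem_mx j i b.
Proof. by rewrite /elem_mx linearD linearZ/= trmx1 trmx_delta. Qed.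

Lemma det_elem_mx n (i j : 'I_n) b : i != j -> \det (elem_mx i j b) = 1.
Proof. by move=> ij; rewrite /elem_mx -emb_transv// det_emb_upper. Qed.

Section Emb1.
Variable n : nat.
Implicit Types D E : 'M[K]_n.

Definition emb1 D : 'M[K]_n.+1 := block_mx 1%:M 0 0 D : 'M_(1 + n).

Let ord0_lshift : (0 : 'I_n.+1) = lshift n (0 : 'I_1).
Proof. exact: val_inj. Qed.

Lemma emb1_lift D i j : emb1 D (lift 0 i) (lift 0 j) = D i j.
Proof. by rewrite -!rshift1; exact: block_mxEdr. Qed.

Lemma emb1_lift0 D i : emb1 D (lift 0 i) 0 = 0.
Proof.
rewrite -rshift1 [X in emb1 D _ X]ord0_lshift.
by apply: etrans (block_mxEdl _ _ _ _ _ _) _; rewrite mxE.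
Qed.

Lemma emb1_0lift D i : emb1 D 0 (lift 0 i) = 0.
Proof.
rewrite -rshift1 [X in emb1 D X _]ord0_lshift.
by apply: etrans (block_mxEur _ _ _ _ _ _) _; rewrite mxE.
Qed.

Lemma emb1_00 D : emb1 D 0 0 = 1.
Proof.
rewrite [X in emb1 D X X]ord0_lshift.
by apply: etrans (block_mxEul _ _ _ _ _ _) _; rewrite mxE.
Qed.

Definition emb1E := (emb1_lift, emb1_lift0, emb1_0lift, emb1_00).

Lemma det_emb1 D : \det (emb1 D) = \det D.
Proof.
have : \det (block_mx (1%:M : 'M[K]_1) 0 0 D) = \det D.
  by rewrite det_ublock det1 mul1r.
exact.
Qed.

Lemma emb1M D E : emb1 (D *m E) = emb1 D *m emb1 E.
Proof.
have : block_mx (1%:M : 'M[K]_1) 0 0 (D *m E) =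
    block_mx 1%:M 0 0 D *m block_mx 1%:M 0 0 E.
  by rewrite mulmx_block !(mul1mx, mulmx0, mul0mx, addr0, add0r).
exact.
Qed.

Lemma emb1_elem i j b : emb1 (elem_mx i j b) = elem_mx (lift 0 i) (lift 0 j) b.
Proof.
apply/matrixP => k l.
have [k'|] := unliftP 0 k => ->; have [l'|] := unliftP 0 l => ->; rewrite !emb1E.
- by rewrite !mxE !(inj_eq lift_inj).
- by rewrite !mxE /= andbF mulr0 addr0.
- by rewrite !mxE /= mulr0 addr0.
- by rewrite !mxE /= mulr0 addr0.
Qed.

Lemma emb1_tr D : (emb1 D)^T = emb1 D^T.
Proof.
apply/matrixP => k l; rewrite mxE.
by have [k'|] := unliftP 0 k => ->; have [l'|] := unliftP 0 l => ->;
  rewrite !emb1E// mxE.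
Qed.

Lemma emb1_1 : emb1 1%:M = 1%:M.
Proof. by have := @scalar_mx_block K 1 n 1; rewrite /emb1 => <-. Qed.

End Emb1.

(** Division-free elimination: it clears the first column when the corner entry is 1, which
    [elem_generation] arranges beforehand. *)
Definition clear_mx n (A : 'M[K]_n.+1) : 'M[K]_n.+1 :=
  \matrix_(i, l) (if i == 0 then A 0 l else A i l - A i 0 * A 0 l).

Lemma clear_column n (S : 'M[K]_n.+1 -> Prop) A :
  elem_closed S -> S (clear_mx A) -> S A.
Proof.
move=> Scl SA.
(* Only the rows in [r] are cleared; since [0] is never in [r], row 0 stays available for the next
   operation. *)
pose A_ (r : seq 'I_n.+1) : 'M[K]_n.+1 :=
  \matrix_(i, l) (if i \in r then A i l - A i 0 * A 0 l else A i l).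
have clear_seq (r : seq 'I_n.+1) : uniq r -> 0 \notin r -> S (A_ r) -> S A.
  elim: r => [|i r IH] /=.
    by move=> _ _; suff -> : A_ [::] = A by []; apply/matrixP => k l; rewrite mxE.
  move=> /andP[ir ur]; rewrite inE negb_or => /andP[i0 r0] Sir.
  apply: IH => //; apply: (Scl i 0 (- A i 0)); first by rewrite eq_sym.
  suff -> : elem_mx i 0 (- A i 0) *m A_ r = A_ (i :: r) by [].
  apply/matrixP => k l; rewrite elem_mx_mulE !mxE inE (negPf r0).
  by have [->|ki] := eqVneq k i; rewrite /= ?(negPf ir); ring.
apply: (clear_seq (enum (predC1 0))); rewrite ?enum_uniq ?mem_enum ?inE ?eqxx//.
suff -> : A_ (enum (predC1 0)) = clear_mx A by [].
apply/matrixP => k l; rewrite !mxE mem_enum inE.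
by case: eqP => // ->.
Qed.

(** Gaussian elimination: once the corner entry is 1, the first column and then, by transposition,
    the first row are cleared, leaving a smaller block with the same determinant. *)
Lemma elem_generation n (S : 'M[K]_n -> Prop) :
  S 1%:M -> elem_closed S -> elem_closed (tr_pred S) ->
  forall A, \det A = 1 -> S A.
Proof.
elim: n S => [|[|n] IH] S S1 Scl Strcl A detA.
- by suff -> : A = 1%:M by []; apply/matrixP => -[].
- suff -> : A = 1%:M by [].
  by move: detA; rewrite [A]mx11_scalar det_scalar1 => ->.
pose S' (B : 'M[K]_n.+2) := \det B = 1 -> S B.
have S'cl : elem_closed S'.
  move=> i j b B ij SB detB; apply: (Scl i j b) => //; apply: SB.
  by rewrite det_mulmx detB det_elem_mx// mulr1.
have S'trcl : elem_closed (tr_pred S').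
  move=> i j b B ij SB detB; apply: (Strcl i j b) => //; apply: SB.
  by rewrite det_tr det_mulmx -(det_tr B) detB det_elem_mx// mulr1.
suff: S' A by exact.
have clear (B : 'M[K]_n.+2) : B 0 0 = 1 -> S' B.
  move=> B00; apply: (clear_column S'cl).
  have: forall i, clear_mx B i 0 = (i == 0)%:R.
    move=> i; rewrite mxE; case: eqP => _; first by rewrite B00.
    by rewrite B00 mulr1 subrr.
  move: (clear_mx B) => C C0; rewrite -[C]trmxK.
  apply: (@clear_column _ (tr_pred S') C^T S'trcl); rewrite /tr_pred.
  have clE i j : (clear_mx C^T)^T i j = if j == 0 then C i 0 else C i j - C 0 j
    * C i 0.
    by rewrite !mxE.
  pose D := \matrix_(i, j) C (lift 0 i) (lift 0 j).
  have -> : (clear_mx C^T)^T = emb1 D.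
    apply/matrixP => i j; rewrite clE !C0.
    have [i'|] := unliftP 0 i => ->; have [j'|] := unliftP 0 j => -> /=.
    - by rewrite emb1_lift mxE mulr0 subr0.
    - by rewrite emb1_lift0.
    - by rewrite emb1_0lift mulr1 subrr.
    - by rewrite emb1_00.
  move: D => D detD.
  have {}detD : \det D = 1 by rewrite -det_emb1.
  suff: forall D, \det D = 1 -> S' (emb1 D) by move=> /(_ D detD); apply;
    rewrite det_emb1.
  apply: (IH (fun D => S' (emb1 D))).
  - by rewrite emb1_1.
  - move=> k l b E kl; rewrite emb1M emb1_elem; apply: S'cl.
    by rewrite (inj_eq lift_inj).
  move=> k l b E kl; rewrite /tr_pred -!emb1_tr emb1M emb1_elem; apply: S'trcl.
  by rewrite (inj_eq lift_inj).
have [i Ai0] : exists i, A i 0 != 0.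
  apply/existsP; apply: contraT => /existsPn A0; move: detA.
  rewrite (expand_det_col _ 0) big1 => [/esym/eqP|i _]; first by rewrite oner_eq0.
  by have := A0 i; rewrite negbK => /eqP ->; rewrite mul0r.
(* A nonzero entry below the corner allows the corner to be set to 1. If only the corner is nonzero,
   row 0 is first added to row 1. *)
have pivot (B : 'M[K]_n.+2) (k : 'I_n.+2) : k != 0 -> B k 0 != 0 -> S' B.
  move=> k0 Bk0; apply: (S'cl 0 k ((1 - B 0 0) / B k 0)); first by rewrite eq_sym.
  by apply: clear; rewrite elem_mx_mulE eqxx mul1r divfK// addrC subrK.
have [i0|i0] := eqVneq i 0; last exact: pivot Ai0.
have [A10|A10] := eqVneq (A 1 0) 0; last by apply: pivot A10.
apply: (S'cl 1 0 1) => //; apply: (pivot _ 1) => //.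
by rewrite elem_mx_mulE eqxx A10 !mul1r add0r; rewrite i0 in Ai0.
Qed.
End Generation.

(** * Topology of the special linear group *)

Section TopologicalFields.
Variable K : topologicalFieldType.

Section Limits.
Context {T : Type} {F : set_system T} {FF : Filter F}.
Implicit Types (f g : T -> K) (a b : K).

Lemma field_cvgD f g a b :
  f t @[t --> F] --> a -> g t @[t --> F] --> b ->
  f t + g t @[t --> F] --> a + b.
Proof. by apply: continuous2_cvg; exact: (@add_continuous K (a, b)). Qed.

Lemma field_cvgM f g a b :
  f t @[t --> F] --> a -> g t @[t --> F] --> b ->
  f t * g t @[t --> F] --> a * b.
Proof. by apply: continuous2_cvg; exact: (@field_mul_continuous K (a, b)). Qed.

Lemma field_cvg_sum I (r : seq I) (f : I -> T -> K) (a : I -> K) :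
  (forall i, f i t @[t --> F] --> a i) ->
  \sum_(i <- r) f i t @[t --> F] --> \sum_(i <- r) a i.
Proof.
move=> fa; elim: r => [|i r IH].
  rewrite big_nil (_ : (fun t => _) = (fun _ => 0)); first exact: cvg_cst.
  by apply/funext => t; rewrite big_nil.
rewrite big_cons (_ : (fun t => _) = (fun t => f i t + \sum_(j <- r) f j t)).
  exact: field_cvgD.
by apply/funext => t; rewrite big_cons.
Qed.

Lemma field_cvg_prod I (r : seq I) (f : I -> T -> K) (a : I -> K) :
  (forall i, f i t @[t --> F] --> a i) ->
  \prod_(i <- r) f i t @[t --> F] --> \prod_(i <- r) a i.
Proof.
move=> fa; elim: r => [|i r IH].
  rewrite big_nil (_ : (fun t => _) = (fun _ => 1)); first exact: cvg_cst.
  by apply/funext => t; rewrite big_nil.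
rewrite big_cons (_ : (fun t => _) = (fun t => f i t * \prod_(j <- r) f j t)).
  exact: field_cvgM.
by apply/funext => t; rewrite big_cons.
Qed.

Lemma cvg_mx m n (f : T -> 'M[K]_(m, n)) (M : 'M[K]_(m, n)) :
  (forall i j, f t i j @[t --> F] --> M i j) -> f t @[t --> F] --> M.
Proof.
move=> fM A [P MP PA].
have : \forall t \near F, forall i j, P i j (f t i j).
  apply: filter_forall => i; apply: filter_forall => j.
  exact: (fM i j (P i j) (MP i j)).
by apply: filterS => t; exact: PA.
Qed.

Lemma cvg_SL d (f : T -> SL K d) (g : SL K d) :
  (forall i j, val (f t) i j @[t --> F] --> val g i j) -> f t @[t --> F] --> g.
Proof.
move=> /cvg_mx fg A [U [[W oW <-]] /= Wg UA].
have FW : \forall t \near F, W (val (f t)) by apply: fg; exact: open_nbhs_nbhs.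
by apply: filterS FW => t Wt; exact: UA.
Qed.

End Limits.

Lemma cvg_entry m n (M : 'M[K]_(m, n)) i j :
  A i j @[A --> nbhs M] --> M i j.
Proof.
move=> U MU; exists (fun k l => if (k == i) && (l == j) then U else setT).
  by move=> k l; case: andP => [[/eqP-> /eqP->]//|_]; exact: filterT.
by move=> A /(_ i j); rewrite !eqxx.
Qed.

Lemma cvg_SL_entry d (g : SL K d) i j : (fun h : SL K d => val h i j) @ g -->
  val g i j.
Proof.
have := @initial_continuous _ _ (val : SL K d -> 'M[K]_d) g.
move=> cg; exact: (cvg_comp _ (fun A : 'M[K]_d => A i j) cg (@cvg_entry d d
  (val g) i j)).
Qed.

Lemma SL_mulr_continuous d (h : SL K d) : continuous (fun g : SL K d => (g *
  h)%g).
Proof.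
move=> g.
apply: (@cvg_SL _ (nbhs g) _ d (fun g => g * h)%g (g * h)%g) => i j /=;
  rewrite mxE.
rewrite (_ : (fun t => _) = (fun t : SL K d => \sum_k val t i k * val h k j)).
  apply: (@field_cvg_sum _ (nbhs g) _) => k; apply: (@field_cvgM _ (nbhs g) _).
    exact: cvg_SL_entry.
  exact: cvg_cst.
by apply/funext => t; rewrite mxE.
Qed.

Lemma transv_cvg1 d (i j : 'I_d) : i != j ->
  transv i j t @[t --> (0 : K)] --> (1%g : SL K d).
Proof.
move=> ij; rewrite -(transv0 K i j); apply: cvg_SL => k l;
  rewrite !val_transv// !mxE.
rewrite (_ : (fun t => _) =
  fun t : K => (k == l)%:R + t * ((k == i) && (l == j))%:R).
  by apply: field_cvgD; [exact: cvg_cst|apply: field_cvgM;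
    [exact: cvg_id|exact: cvg_cst]].
by apply/funext => t; rewrite val_transv// !mxE.
Qed.

End TopologicalFields.

Section LocalFields.
Variable K : localFieldType.

(** Otherwise [[set 0]] would be a neighborhood of 0 and, by translation, every set would be open.
    This turns statements about small parameters into an actual nonzero parameter. *)
Lemma local_field_dnbhs_ex (P : K -> Prop) :
  (\forall t \near (0 : K)^', P t) -> exists2 t, t != 0 & P t.
Proof.
move=> nP; apply: contrapT => noP; apply: (@local_field_nondiscrete K) => A.
have n0 : nbhs (0 : K) [set 0].
  have : nbhs (0 : K) [set t | t != 0 -> P t] by exact: nP.
  apply: filterS => t tP.
  by apply/eqP; apply: contrapT => /negP t0; apply: noP; exists t => //;
    exact: tP.
rewrite openE => x Ax; have : (t - x) @[t --> x] --> (0 : K).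
  rewrite -[X in _ --> X](subrr x).
  apply: (@continuous2_cvg _ K K K (nbhs x) _ id (fun=> x) (fun a b => a - b)).
  - exact: (@sub_continuous K (x, x)).
  - exact: cvg_id.
  - exact: cvg_cst.
move=> /(_ _ n0) nx; have : nbhs x [set t | t - x = 0] by exact: nx.
by apply: filterS => t /= /eqP; rewrite subr_eq0 => /eqP ->.
Qed.

Lemma ultra_compact_cvg (T : Type) (X : topologicalType) (F : set_system T)
    (f : T -> X) (C : set X) :
  UltraFilter F -> compact C -> F (f @^-1` C) ->
  exists2 p, C p & f t @[t --> F] --> p.
Proof.
move=> UF Cc FC; have [p [Cp clp]] := Cc (f t @[t --> F]) _ FC.
exists p => // N pN; rewrite /nbhs /=.
have [//|FN] := in_ultra_setVsetC (f @^-1` N) UF.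
by have [x [Nx nNx]] := clp (~` N) N FN pN.
Qed.

(** Along an ultrafilter each entry converges in its compact neighborhood, and the limit matrix has
    determinant 1 by continuity and uniqueness of limits. *)
Lemma SL_locally_compact d : exists2 V : set (SL K d), nbhs 1%g V & compact V.
Proof.
have locC (x : K) : exists C : set K, nbhs x C /\ compact C.
  have [C xC [Cc _]] := @local_field_locally_compact K x I; exists C; split => //.
  by move: xC; rewrite /within /=; apply: filterS => t; exact.
have [C CP] := choice locC.
pose V := [set g : SL K d | forall i j, C ((1%:M : 'M[K]_d) i j) (val g i j)].
exists V.
  suff : \forall g \near (1%g : SL K d), forall i j,
      C ((1%:M : 'M[K]_d) i j) (val (g : SL K d) i j) by [].
  have FF : Filter (nbhs (1%g : SL K d)) by exact: nbhs_filter.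
  apply: (@filter_forall _ _ _ _ FF) => i;
    apply: (@filter_forall _ _ _ _ FF) => j.
  have [C1 _] := CP ((1%:M : 'M[K]_d) i j).
  exact: (@cvg_SL_entry K d 1%g i j _ C1).
rewrite compact_ultra => F UF FV.
have limF i j : exists p, C ((1%:M : 'M[K]_d) i j) p /\ (fun g : SL K d => val
  g i j) @ F --> p.
  have [_ Cc] := CP ((1%:M : 'M[K]_d) i j).
  have [|p Cp Fp] := ultra_compact_cvg (f := fun g : SL K d => val g i j) UF Cc.
    by apply: filterS FV => g; exact.
  by exists p.
have [p pP] : exists p : 'I_d -> 'I_d -> K, forall i j,
    C ((1%:M : 'M[K]_d) i j) (p i j) /\ (fun g : SL K d => val g i j) @ F --> p
      i j.
  have limFi i : exists q : 'I_d -> K, forall j,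
      C ((1%:M : 'M[K]_d) i j) (q j) /\ (fun g : SL K d => val g i j) @ F --> q j.
    by have [q qP] := choice (limF i); exists q.
  by have [p pP] := choice limFi; exists p.
pose M : 'M[K]_d := \matrix_(i, j) p i j.
have detM : \det M == 1.
  apply/eqP; apply: (cvg_unique (@local_field_hausdorff K) (F := (fun g : SL K
    d => \det (val g)) @ F)).
    rewrite /= /determinant; apply: field_cvg_sum => s; apply: field_cvgM.
      exact: cvg_cst.
    by apply: field_cvg_prod => i; rewrite mxE; exact: (pP _ _).2.
  rewrite (_ : (fun g : SL K d => \det (val g)) = fun _ => 1);
    first exact: cvg_cst.
  by apply/funext => g; rewrite (eqP (valP g)).
exists (Sub M detM : SL K d); split.
  by move=> i j; rewrite /= [X in C _ X]mxE; exact: (pP i j).1.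
by apply: (cvg_SL (f := id)) => i j; rewrite /= [X in _ --> X]mxE;
  exact: (pP i j).2.
Qed.

End LocalFields.

(** * Fixed points of isometries *)

Section Completeness.
Variables (R : realType) (H : hilbertType R).
Implicit Types (x y z : H) (u : nat -> H).

Lemma rnorm_cauchy_lim u :
  (forall e : R, 0 < e -> exists N : nat, forall m n : nat,
     (N <= m)%N -> (N <= n)%N -> rnorm (u m - u n) < e) ->
  exists l, forall e : R, 0 < e -> exists N : nat, forall n : nat,
    (N <= n)%N -> rnorm (l - u n) < e.
Proof.
move=> cu; have : cvg (u @ \oo).
  apply/cauchy_cvgP/cauchy_ballP => e e0.
  have re : e = (complex.Re e)%:C by rewrite RRe_real// gtr0_real.
  have [|N Nu] := cu (complex.Re e); first by rewrite -ltcR -re.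
  exists (u @` [set n | (N <= n)%N], u @` [set n | (N <= n)%N]) => /=.
    by split; exists N => // n Nn; exists n.
  move=> [_ _] [/= [m Nm <-] [n Nn <-]];
    rewrite -ball_normE /= re normr_rnorm ltcR.
  exact: Nu.
move=> /cvg_ex[l ul]; exists l => e e0.
have [N _ NP] := (cvg_rnormP u l _).1 ul e e0.
by exists N => n; exact: NP.
Qed.

Definition norm_closed (S : set H) :=
  forall x, (forall e : R, 0 < e -> exists2 y, S y & rnorm (x - y) < e) -> S x.

Lemma norm_closedP (S : set H) : norm_closed S -> closed S.
Proof.
move=> Scl x clx; apply: Scl => e e0.
have [|y [Sy xy]] := clx [set y | rnorm (x - y) < e]; last by exists y.
by apply/nbhs_rnormP; exists e.
Qed.

Lemma rnorm_le_eq0 (V : normedZmodType R[i]) (x : V) :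
  (forall e : R, 0 < e -> rnorm x <= e) -> x = 0.
Proof.
move=> xe; apply/eqP; rewrite -rnorm_eq0; apply/eqP/le_anti.
by rewrite rnorm_ge0 andbT; apply/ler_addgt0Pl => e e0; rewrite addr0 xe.
Qed.

Lemma exists_inv_lt (e : R) : 0 < e -> exists n : nat, n.+1%:R^-1 < e.
Proof.
move=> e0; exists (Num.bound e^-1); rewrite invf_plt ?posrE ?ltr0n//.
apply: lt_le_trans (archi_boundP _) _; first by rewrite invr_ge0 ltW.
by rewrite ler_nat.
Qed.

(* The element of minimal norm of a closed convex set is unique, hence fixed by
   every isometry preserving the set. *)
Lemma convex_fixed_point (S : set H) (T : set (H -> H)) :
  S !=set0 -> norm_closed S ->
  (forall x y, S x -> S y -> S (2^-1%:C *: (x + y))) ->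
  (forall U, T U -> forall x, S x -> S (U x)) ->
  (forall U, T U -> forall x, rnorm (U x) = rnorm x) ->
  (forall U, T U -> forall x y, rnorm (U x - U y) = rnorm (x - y)) ->
  exists2 p, S p & forall U, T U -> U p = p.
Proof.
move=> [x0 Sx0] Scl Smid TS Tn Tiso.
pose E := [set rnorm x ^+ 2 | x in S]; pose d := inf E.
have Einf : has_inf E.
  split; first by exists (rnorm x0 ^+ 2), x0.
  by exists 0 => _ [x _ <-]; rewrite sqr_ge0.
have dE x : S x -> d <= rnorm x ^+ 2.
  by move=> Sx; apply: ge_inf; [exact: Einf.2|exists x].
(* The midpoint has squared norm at least [d], so by the parallelogram law two almost minimal
   elements are close to each other. *)
have gap x y : S x -> S y ->
    rnorm (x - y) ^+ 2 <= (rnorm x ^+ 2 - d + (rnorm y ^+ 2 - d)) *+ 2.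
  move=> Sx Sy; have := parallelogram x y.
  have := dE _ (Smid _ _ Sx Sy); rewrite rnormZ rnorm_real exprMn.
  have -> : `|2^-1 : R| ^+ 2 = 4^-1 by rewrite ger0_norm ?invr_ge0//; field.
  move: (rnorm (x - y) ^+ 2) (rnorm (x + y) ^+ 2) => a b; lra.
have minseq n : exists x, S x /\ rnorm x ^+ 2 - d < n.+1%:R^-1.
  have n0 : 0 < n.+1%:R^-1 :> R by rewrite invr_gt0 ltr0n.
  have [_ [x Sx <-] xd] := inf_adherent n0 Einf.
  by exists x; split => //; rewrite ltrBlDl.
have [u uP] := choice minseq.
have inv_le (N n : nat) : (N <= n)%N -> n.+1%:R^-1 <= N.+1%:R^-1 :> R.
  by move=> Nn; rewrite lef_pV2 ?posrE ?ltr0n// ler_nat.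
have ugap (N m n : nat) : (N <= m)%N -> (N <= n)%N ->
    rnorm (u m - u n) ^+ 2 < 4 * N.+1%:R^-1.
  move=> Nm Nn; have [Sm um] := uP m; have [Sn un] := uP n.
  have := gap _ _ Sm Sn; have := inv_le _ _ Nm; have := inv_le _ _ Nn.
  move: um un; move: (m.+1%:R^-1) (n.+1%:R^-1) (N.+1%:R^-1) => a b c; lra.
have small (e : R) : 0 < e -> exists N : nat, 4 * N.+1%:R^-1 < e ^+ 2 :> R.
  move=> e0; have [|N Ne] := @exists_inv_lt (e ^+ 2 / 4).
    by rewrite divr_gt0// exprn_gt0.
  by exists N; rewrite mulrC -ltr_pdivlMr.
have [|p pP] := @rnorm_cauchy_lim u.
  move=> e e0; have [N Ne] := small e e0; exists N => m n Nm Nn.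
  rewrite -(@ltr_pXn2r _ 2)// ?nnegrE ?rnorm_ge0 ?ltW//.
  exact: lt_trans (ugap N m n Nm Nn) Ne.
exists p.
  apply: Scl => e e0; have [N NP] := pP e e0; exists (u N); last exact: NP.
  by have [] := uP N.
(* [U] sends the almost minimal [u n] to an element of [S] of the same norm, hence close to [u n] by
   [gap]; and [u n] is close to [p]. *)
move=> U TU; apply/eqP; rewrite -subr_eq0; apply/eqP/rnorm_le_eq0 => e e0.
have e4 : 0 < e / 4 by lra.
have [N1 N1P] := pP _ e4; have [N2 N2P] := small _ e4.
pose n := maxn N1 N2.
have n1 : rnorm (p - u n) < e / 4 by apply: N1P; exact: leq_maxl.
have n2 : rnorm (U p - U (u n)) < e / 4 by rewrite Tiso.
have [Sn un] := uP n.
have n3 : rnorm (U (u n) - u n) < e / 2.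
  rewrite -(@ltr_pXn2r _ 2)// ?nnegrE ?rnorm_ge0 ?divr_ge0 ?ltW//.
  have -> : (e / 2) ^+ 2 = 4 * (e / 4) ^+ 2 by field.
  have := gap _ _ (TS _ TU _ Sn) Sn; rewrite (Tn _ TU).
  have := inv_le N2 n (leq_maxr _ _); move: un N2P (sqr_ge0 (e / 4)).
  by move: (n.+1%:R^-1) (N2.+1%:R^-1) ((e / 4) ^+ 2) => a b c; lra.
have -> : U p - p = (U p - U (u n)) + (U (u n) - u n) + (u n - p).
  by rewrite !subrKA.
have := ler_rnormD (U p - U (u n) + (U (u n) - u n)) (u n - p).
have := ler_rnormD (U p - U (u n)) (U (u n) - u n).
rewrite (rdistrC (u n)); lra.
Qed.

End Completeness.

(** * Decay of matrix coefficients *)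

Lemma scaler_half (R : realType) (V : lmodType R[i]) (y : V) :
  y = 2^-1%:C *: (y + y).
Proof.
have half : 2^-1%:C * 2 = 1 :> R[i].
  rewrite -(rmorph_nat (real_complex R) 2) -rmorphM mulVf ?pnatr_eq0//.
by rewrite -mulr2n -scaler_nat scalerA half scale1r.
Qed.

Section UnitaryRep.
Variables (G : preTopologicalGroupType) (R : realType) (H : hilbertType R).
Variable rho : unitary_rep G H.
Implicit Types (g : G) (x y : H).

Lemma urepD g x y : rho g (x + y) = rho g x + rho g y.
Proof.
by have [lin _ _] := urep_unitary rho g; have := lin 1 x y; rewrite !scale1r.
Qed.

Lemma urepB g x y : rho g (x - y) = rho g x - rho g y.
Proof. by rewrite urepD -[- y]scaleN1r urepZ scaleN1r. Qed.

Lemma urep0 g : rho g 0 = 0.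
Proof. by have := urepB g 0 0; rewrite !subrr. Qed.

Lemma urep_inner g x y : inner (rho g x) (rho g y) = inner x y.
Proof. by have [_ + _] := urep_unitary rho g; apply. Qed.

Lemma urep_rnorm g x : rnorm (rho g x) = rnorm x.
Proof.
apply/eqP; rewrite -(@eqrXn2 _ 2)// ?rnorm_ge0//.
by apply/eqP/complexI; rewrite -!innerxx urep_inner.
Qed.

Lemma urepK g : cancel (rho g) (rho g^-1%g).
Proof. by move=> x; rewrite -urepM mulVg urep1. Qed.

Lemma urepVK g : cancel (rho g^-1%g) (rho g).
Proof. by move=> x; rewrite -urepM mulgV urep1. Qed.

Lemma urep_adj g x y : inner (rho g x) y = inner x (rho g^-1%g y).
Proof. by rewrite -{1}(urepVK g y) urep_inner. Qed.

Lemma fixed_of_inner g x : inner (rho g x) x = inner x x -> rho g x = x.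
Proof.
move=> gx; apply/eqP; rewrite -subr_eq0 -rnorm_eq0 -sqrf_eq0.
rewrite rnorm_sqrB gx innerxx urep_rnorm /=; apply/eqP; ring.
Qed.

Lemma fixedM g h x : rho g x = x -> rho h x = x -> rho (g * h)%g x = x.
Proof. by move=> gx hx; rewrite urepM hx gx. Qed.

Lemma fixedV g x : rho g x = x -> rho g^-1%g x = x.
Proof. by move=> gx; rewrite -{1}gx urepK. Qed.

Lemma inner_bifixed g h k x : rho g x = x -> rho k x = x ->
  inner (rho (g * h * k)%g x) x = inner (rho h x) x.
Proof. by move=> gx kx; rewrite !urepM kx urep_adj fixedV. Qed.

(** If the fixed vectors were more than 0, irreducibility would make the representation trivial.
    Every closed subspace is then invariant, in particular the orthogonal complement of [x0], and
    [H] would be spanned by [x0]. *)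
Lemma irreducible_fixed x :
  irreducible rho -> infinite_dimensional H -> (forall g, rho g x = x) -> x = 0.
Proof.
move=> [[x0 x00] irr] infH fx.
pose M := [set y : H | forall g, rho g y = y].
have [||||M0|M0] := irr M.
- apply: norm_closedP => y yM g; apply/eqP; rewrite -subr_eq0; apply/eqP.
  apply: rnorm_le_eq0 => e e0; have [|z Mz yz] := yM (e / 2); first by lra.
  have -> : rho g y - y = rho g (y - z) + (z - y).
    by rewrite urepB Mz subrKA.
  have := ler_rnormD (rho g (y - z)) (z - y); rewrite urep_rnorm (rdistrC z).
  lra.
- by move=> g; rewrite urep0.
- by move=> a y z My Mz g; rewrite urepD urepZ My Mz.
- by move=> g y My h; rewrite !My.
- by have : M x by []; rewrite M0 => ->.
have fall g y : rho g y = y by have : M y by rewrite M0.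
case: infH; pose N := [set y : H | inner y x0 = 0].
have nx0 : inner x0 x0 != 0.
  by rewrite innerxx (inj_eq (@complexI R) _ 0) sqrf_eq0 rnorm_eq0.
have [||||N0|NT] := irr N.
- apply: norm_closedP => y yN; rewrite /N /=; apply: rnorm_le_eq0 => e e0.
  have x0p : 0 < rnorm x0 by rewrite rnorm_gt0.
  have [|z Nz yz] := yN (e / rnorm x0); first by rewrite divr_gt0.
  rewrite -[inner y x0]subr0 -Nz -innerBl.
  apply: le_trans (cauchy_schwarz _ _) _.
  by rewrite -ler_pdivlMr// ltW.
- exact: inner0l.
- by move=> a y z Ny Nz; rewrite /N /= innerDl innerZl Ny Nz mulr0 addr0.
- by move=> g y Ny; rewrite fall.
- exists 1%N, (fun _ => x0) => v; exists (fun _ => inner v x0 / inner x0 x0).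
  rewrite big_ord1; apply/eqP; rewrite -subr_eq0; apply/eqP.
  have : N (v - (inner v x0 / inner x0 x0) *: x0).
    by rewrite /N /= innerBl innerZl divfK// subrr.
  by rewrite N0.
by have : N x0 by [rewrite NT]; move=> Nx0; rewrite -Nx0 eqxx in nx0.
Qed.

End UnitaryRep.

Section HoweMoore.
Variables (K : localFieldType) (d : nat) (R : realType) (H : hilbertType R).
Variable rho : unitary_rep (SL K d) H.
Hypothesis rho_cont : strongly_continuous rho.
Implicit Types (x y z : H) (i j k l : 'I_d).

Lemma near_transv i j x (f : K -> K) (e : R) : i != j ->
  f t @[t --> (0 : K)] --> (0 : K) -> 0 < e ->
  \forall t \near (0 : K), rnorm (rho (transv i j (f t)) x - x) < e.
Proof.
move=> ij f0 e0; have ct := @transv_cvg1 K d i j ij.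
have := cvg_comp _ _ (cvg_comp _ _ f0 ct) (@rho_cont x 1%g).
move=> /cvg_rnormP => /(_ e e0); apply: filterS => t.
by rewrite urep1 rdistrC.
Qed.

Lemma cvg0_mul (f : K -> K) (c : K) : f t @[t --> (0 : K)] --> (0 : K) ->
  f t * c @[t --> (0 : K)] --> (0 : K).
Proof.
by move=> f0; rewrite -[X in _ --> X](mul0r c); apply: field_cvgM f0 _;
  exact: cvg_cst.
Qed.

(** The parameter [(coef k)^-1 * b * coef l] of [transv_torusJ] for the root subgroups that
    [torus i j s] contracts, written without inverses so as to be continuous at [s = 0]. *)
Definition torus_ratio i j k l (b s : K) : K :=
  (if k == j then s else 1) * (b * (if l == i then s else 1)).

Lemma torus_ratio_cvg0 i j k l b : (k == j) || (l == i) ->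
  torus_ratio i j k l b s @[s --> (0 : K)] --> (0 : K).
Proof.
move=> kl; rewrite -[X in _ --> X](_ : torus_ratio i j k l b 0 = 0); last first.
  rewrite /torus_ratio; case/orP: kl => ->; rewrite ?mul0r//.
  by rewrite !mulr0.
by apply: field_cvgM; [|apply: field_cvgM; [exact: cvg_cst|]];
  case: ifP => _; [exact: cvg_id|exact: cvg_cst|exact: cvg_id|exact: cvg_cst].
Qed.

Lemma transv_torus_ratio i j k l b s : i != j -> k != l ->
  (k == j) || (l == i) -> s != 0 ->
  (transv k l b * torus i j s)%g =
  (torus i j s * transv k l (torus_ratio i j k l b s))%g.
Proof.
move=> ij kl klij s0; rewrite transv_torusJ//; congr (_ * transv k l _)%g.
rewrite /torus_ratio !mxE -mulrA.
have [ki|ki] := eqVneq k i.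
  by move: klij; rewrite ki (negPf ij) eq_sym -ki (negPf kl).
have [kj|kj] := eqVneq k j.
  have lj : (l == j) = false by rewrite eq_sym -kj (negPf kl).
  by rewrite invrK lj; case: ifP.
have li : l == i by move: klij; rewrite (negPf kj).
by rewrite li invr1.
Qed.

(** The converse passage, from torus to transvections: as [D(s)] is isometric and fixes [x], a
    transvection displaces [x] exactly as much as its contraction by [D(s)], and this tends to 0
    with [s]. *)
Lemma torus_fixed_transv i j k l b x : i != j -> k != l ->
  (k == j) || (l == i) -> (forall s, s != 0 -> rho (torus i j s) x = x) ->
  rho (transv k l b) x = x.
Proof.
move=> ij kl klij fx; apply/eqP; rewrite -subr_eq0;
  apply/eqP/rnorm_le_eq0 => e e0.
have n1 := near_transv x kl (@torus_ratio_cvg0 i j k l b klij) e0.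
have [s s0 /ltW] := local_field_dnbhs_ex (nbhs_dnbhs n1).
rewrite -{1}(urep_rnorm rho (torus i j s)) urepB -urepM -transv_torus_ratio//.
by rewrite urepM fx.
Qed.

(* Mautner: by [transv_torus] the matrix coefficient of [x] takes the same value
   at [transv j i t] and at [torus i j s * transv j i (t * s)]; let [t -> 0]. *)
Lemma transv_fixed_torus i j s x : i != j -> s != 0 ->
  (forall b, rho (transv i j b) x = x) -> rho (torus i j s) x = x.
Proof.
move=> ij s0 fx; have ji : j != i by rewrite eq_sym.
apply: fixed_of_inner; apply/eqP; rewrite -subr_eq0;
  apply/eqP/rnorm_le_eq0 => e e0.
pose c := rnorm x + 1; have c0 : 0 < c by rewrite ltr_wpDl ?rnorm_ge0.
have e2 : 0 < e / 2 / c by rewrite !divr_gt0.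
have n1 := near_transv x ji (@cvg_id _ (nbhs (0 : K))) e2.
have n2 := near_transv x ji (cvg0_mul s (@cvg_id _ (nbhs (0 : K)))) e2.
have [t t0 [t1 t2]] := local_field_dnbhs_ex (nbhs_dnbhs (filterI n1 n2)).
have small u : rnorm u < e / 2 / c -> rnorm (inner u x) <= e / 2.
  move=> uc; apply: le_trans (cauchy_schwarz _ _) _.
  rewrite -[leRHS](@divfK _ c) ?gt_eqF//; apply: ler_pM; rewrite ?rnorm_ge0//.
    exact: ltW.
  by rewrite lerDl.
have eq : inner (rho (transv j i t) x) x = inner (rho (torus i j s * transv j i
  (t * s))%g x) x.
  by rewrite -(transv_torus ij s0 t0); apply/esym/inner_bifixed; exact: fx.
have -> : inner (rho (torus i j s) x) x - inner x x =
    inner (rho (transv j i t) x - x) x -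
    inner (rho (torus i j s) (rho (transv j i (t * s)) x - x)) x.
  by rewrite urepB !innerBl eq urepM; ring.
apply: le_trans (ler_rnormD _ _) _; rewrite rnormN [leRHS](splitr e).
by apply: lerD; apply: small; rewrite ?urep_rnorm.
Qed.

(** One of [torus i j] and [torus j i] contracts any root subgroup that shares an index with [i, j];
    the other root subgroups are reached by commutators through the index [i]. *)
Lemma transv_fixed i j x : i != j -> (forall b, rho (transv i j b) x = x) ->
  forall g, rho g x = x.
Proof.
move=> ij fx; have ji : j != i by rewrite eq_sym.
have f1 s : s != 0 -> rho (torus i j s) x = x.
  by move=> s0; exact: transv_fixed_torus.
have f2 s : s != 0 -> rho (torus j i s) x = x.
  by move=> s0; rewrite -torus_inv// f1// invr_eq0.
have touch k l b : k != l -> [|| k == j, l == i, k == i | l == j] ->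
    rho (transv k l b) x = x.
  move=> kl; rewrite orbA => /orP[] klij.
    exact: (torus_fixed_transv _ ij kl klij f1).
  exact: (torus_fixed_transv _ ji kl klij f2).
have fT k l b : k != l -> rho (transv k l b) x = x.
  move=> kl; have [|] := boolP [|| k == j, l == i, k == i | l == j].
    exact: touch.
  rewrite !negb_or => /and4P[kj li ki lj].
  have il : i != l by rewrite eq_sym.
  rewrite -[b]mulr1 (transv_comm _ _ ki il kl).
  do !apply: fixedM; rewrite ?touch ?eqxx ?orbT//;
    by apply: fixedV; rewrite touch ?eqxx ?orbT.
pose S (A : 'M[K]_d) := forall g : SL K d, val g = A -> rho g x = x.
move=> g; apply: (@elem_generation K d S) (eqP (valP g)) g erefl.
- by move=> h h1; have -> : h = 1%g by [apply: val_inj]; rewrite urep1.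
- move=> k l b A kl SA h hA.
  have : rho (transv k l b * h)%g x = x.
    by apply: SA; rewrite /= val_transv// hA.
  by rewrite urepM => /(canRL (urepK _ _)) ->; apply: fixedV; exact: fT.
- move=> k l b A kl SA h hA.
  have : rho (h * transv l k b)%g x = x.
    apply: SA; rewrite /= val_transv 1?eq_sym// hA -tr_elem_mx.
    by rewrite trmx_mul !trmxK.
  by rewrite urepM fT// eq_sym.
Qed.

Hypotheses (irr : irreducible rho) (infH : infinite_dimensional H).

Lemma no_transv_fixed i j x : i != j ->
  (forall b, rho (transv i j b) x = x) -> x = 0.
Proof. by move=> ij fx; apply: (irreducible_fixed irr infH);
  exact: transv_fixed fx. Qed.

(** [S] collects the [z] whose coefficients are asymptotic to those of [y]. It contains [y], is
    closed and stable under midpoints, and is invariant under the root subgroup that [D(s)]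
    contracts. Its element of minimal norm is fixed by this subgroup, hence 0, and [S 0] is the
    claim. *)
Lemma torus_decay i j x y (e : R) : i != j -> 0 < e ->
  \forall s \near (0 : K)^', rnorm (inner (rho (torus i j s) x) y) < e.
Proof.
move=> ij; have ji : j != i by rewrite eq_sym.
pose S := [set z : H | forall x (e : R), 0 < e ->
  \forall s \near (0 : K)^', rnorm (inner (rho (torus i j s) x) (z - y)) < e].
pose T := [set rho (transv j i b) | b in setT].
have [||||||p Sp Tp] := @convex_fixed_point R H S T.
- exists y => u e1 e10; apply: nearW => s.
  by rewrite subrr inner0r rnorm0.
- move=> z zS u e1 e10; have c0 : 0 < rnorm u + 1 by rewrite ltr_wpDl ?rnorm_ge0.
  have [|w Sw zw] := zS (e1 / 2 / (rnorm u + 1)); first by rewrite !divr_gt0.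
  have e2 : 0 < e1 / 2 by rewrite divr_gt0.
  apply: filterS (Sw u _ e2) => s; set D := rho _ u => Dw.
  rewrite -(subrKA w) innerDr [ltRHS](splitr e1) addrC.
  apply: le_lt_trans (ler_rnormD _ _) _; apply: ltr_leD => //.
  apply: le_trans (cauchy_schwarz _ _) _; rewrite urep_rnorm mulrC.
  rewrite -[leRHS](@divfK _ (rnorm u + 1)) ?gt_eqF//.
  by apply: ler_pM; rewrite ?rnorm_ge0// ?lerDl// ltW.
- move=> z w Sz Sw u e1 e10; apply: filterS2 (Sz u _ e10) (Sw u _ e10) => s.
  set D := rho _ u => Dz Dw.
  have -> : 2^-1%:C *: (z + w) - y = 2^-1%:C *: ((z - y) + (w - y)).
    by rewrite addrACA -opprD scalerBr -scaler_half.
  rewrite rnorm_innerZr rnorm_real ger0_norm ?invr_ge0// innerDr.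
  have := ler_rnormD (inner D (z - y)) (inner D (w - y)); lra.
- move=> _ [b _ <-] z Sz u e1 e10.
  have e2 : 0 < e1 / 2 by rewrite divr_gt0.
  have c0 : 0 < rnorm z + 1 by rewrite ltr_wpDl ?rnorm_ge0.
  have e3 : 0 < e1 / 2 / (rnorm z + 1) by rewrite divr_gt0.
  have klij : (j == j) || (i == i) by rewrite eqxx.
  (* Moved to the other argument and then past [D(s)], the transvection gets a parameter that tends
     to 0. *)
  have nb := near_transv u ji (@torus_ratio_cvg0 i j j i (- b) klij) e3.
  apply: filterS3 (nbhs_dnbhs_neq (0 : K)) (nbhs_dnbhs nb) (Sz u _ e2).
  move=> s s0 us zs; have -> : rho (transv j i b) z - y =
    (z - y) + (rho (transv j i b) z - z) by rewrite [RHS]addrC subrKA.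
  rewrite innerDr [inner _ (rho _ z - z)]innerBr -(invgK (transv j i b))
    -urep_adj transvV// -urepM.
  rewrite (transv_torus_ratio _ ij ji klij s0) urepM -innerBl -urepB.
  rewrite [ltRHS](splitr e1).
  apply: le_lt_trans (ler_rnormD _ _) _; apply: ltr_leD => //.
  apply: le_trans (cauchy_schwarz _ _) _; rewrite urep_rnorm.
  rewrite -[leRHS](@divfK _ (rnorm z + 1)) ?gt_eqF//.
  by apply: ler_pM; rewrite ?rnorm_ge0// ?lerDl// ltW.
- by move=> _ [b _ <-] z; rewrite urep_rnorm.
- by move=> _ [b _ <-] z w; rewrite -urepB urep_rnorm.
move=> e0; have p0 : p = 0.
  by apply: (no_transv_fixed ji) => b; apply: Tp; exists b.
apply: filterS (Sp x e e0) => s; rewrite p0 sub0r -scaleN1r rnorm_innerZr.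
by rewrite rnormN /rnorm normr1 /= mul1r.
Qed.

End HoweMoore.

Lemma near_all_mem (I : eqType) (s : seq I) (T : Type) (F : set_system T)
    (P : I -> T -> Prop) : Filter F ->
  (forall i, i \in s -> \forall t \near F, P i t) ->
  \forall t \near F, forall i, i \in s -> P i t.
Proof.
move=> FF; elim: s => [|i s IH] sP; first by apply: nearW.
have n1 := sP i (mem_head _ _).
have n2 : \forall t \near F, forall j, j \in s -> P j t.
  by apply: IH => j js; apply: sP; rewrite inE js orbT.
apply: filterS2 n1 n2 => t Pi Ps j; rewrite inE => /predU1P[->//|].
exact: Ps.
Qed.

Section LocalFieldPoints.
Variable K : localFieldType.

Lemma dnbhs0_neq (c : K) : \forall t \near (0 : K)^', t != c.
Proof.
have [->|c0] := eqVneq c 0; first exact: nbhs_dnbhs_neq.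
have : nbhs (0 : K) (~` [set c]).
  apply: open_nbhs_nbhs; split; last by move=> /= /esym/eqP; apply/negP.
  apply: closed_openC; apply: accessible_closed_set1.
  exact: hausdorff_accessible local_field_hausdorff.
by move=> /nbhs_dnbhs; apply: filterS => t /= tc; apply/eqP.
Qed.

Lemma dnbhs0_points (P : K -> Prop) m : (\forall t \near (0 : K), P t) ->
  exists b : 'I_m -> K, injective b /\ forall i, P (b i).
Proof.
move=> nP; suff [s [<- us sP]] : exists s : seq K,
    [/\ size s = m, uniq s & forall b, b \in s -> P b].
  exists (fun i => nth 0 s i); split; last by move=> i; apply: sP; exact: mem_nth.
  by move=> i j /eqP; rewrite nth_uniq// => /eqP; exact: val_inj.
elim: m => [|m [s [<- us sP]]]; first by exists [::].
have ns := near_all_mem (dnbhs_filter (0 : K)) (fun c (_ : c \in s) =>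
  dnbhs0_neq c).
have [t _ [Pt ts]] := local_field_dnbhs_ex (filterI (nbhs_dnbhs nP) ns).
exists (t :: s); split => //=.
  by rewrite us andbT; apply/negP => /ts; rewrite eqxx.
by move=> b; rewrite inE => /predU1P[->//|]; exact: sP.
Qed.

Lemma dnbhs0_sqr (P : K -> Prop) (b : K) : b != 0 ->
  (\forall t \near (0 : K)^', P t) -> \forall c \near (0 : K)^', P (c * (b * c)).
Proof.
move=> b0 nP; have f0 : c * (b * c) @[c --> (0 : K)] --> (0 : K).
  rewrite -[X in _ --> X](mul0r (b * 0)).
  apply: field_cvgM; first exact: cvg_id.
  by apply: field_cvgM; [exact: cvg_cst|exact: cvg_id].
have n0 : nbhs (0 : K) [set c | c * (b * c) != 0 -> P (c * (b * c))].
  exact: (f0 [set t | t != 0 -> P t] nP).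
apply: filterS2 (nbhs_dnbhs n0) (nbhs_dnbhs_neq (0 : K)) => c Pc c0.
by apply: Pc; rewrite !mulf_neq0.
Qed.

End LocalFieldPoints.

Lemma urep_inner_quot (G : preTopologicalGroupType) (R : realType)
    (H : hilbertType R) (rho : unitary_rep G H) (g h : G) (x y : H) :
  inner (rho (h^-1 * g)%g x) y = inner (rho g x) (rho h y).
Proof. by rewrite urepM urep_adj invgK. Qed.

(** * Blocks of group elements that are spread out in the representation *)

Section OrbitBlock.
Variables (K : localFieldType) (d : nat) (R : realType) (H : hilbertType R).
Variable rho : unitary_rep (SL K d) H.
Hypotheses (rho_cont : strongly_continuous rho) (irr : irreducible rho).
Hypothesis infH : infinite_dimensional H.
Implicit Types (x y z : H) (i j : 'I_d).

(** In [weyl_transv] at [1/t] the outer factors have parameter [t] and are removed at small cost;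
    what remains is a coefficient of [torus j i t]. *)
Lemma transv_decay i j x y (e : R) : i != j -> 0 < e ->
  \forall t \near (0 : K)^', rnorm (inner (rho (transv i j t^-1) x) y) < e.
Proof.
move=> ij e0; have ji : j != i by rewrite eq_sym.
have e3 : 0 < e / 3 by rewrite divr_gt0.
have x1 : 0 < rnorm x + 1 by rewrite ltr_wpDl ?rnorm_ge0.
have y1 : 0 < rnorm y + 1 by rewrite ltr_wpDl ?rnorm_ge0.
have id0 := @cvg_id _ (nbhs (0 : K)).
have opp0 : - t @[t --> (0 : K)] --> (0 : K).
  by rewrite -[X in _ --> X]oppr0; exact: (@opp_continuous K 0).
have nx := near_transv rho_cont x ji id0 (divr_gt0 e3 y1).
have ny := near_transv rho_cont y ji opp0 (divr_gt0 e3 x1).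
pose w := (transv j i (-1) * transv i j 1 * transv j i (-1))%g : SL K d.
have nD := torus_decay rho_cont irr infH (rho w x) y ji e3.
apply: filterS3 (filterI (nbhs_dnbhs nx) (nbhs_dnbhs ny)) nD (nbhs_dnbhs_neq (0
  : K)).
move=> t [tx ty] tD t0; rewrite weyl_transv ?invr_eq0// invrK torus_inv// -/w.
rewrite urepM urepM urepM urep_adj transvV//.
set x' := rho _ x in tx *; set y' := rho _ y in ty *;
  set D := torus j i t in tD *.
have -> : inner (rho D (rho w x')) y' = inner (rho D (rho w x)) y +
    inner (rho D (rho w (x' - x))) y + inner (rho D (rho w x')) (y' - y).
  by rewrite !urepB innerBl innerBr; ring.
have bx : rnorm (inner (rho D (rho w (x' - x))) y) <= e / 3.
  apply: le_trans (cauchy_schwarz _ _) _; rewrite !urep_rnorm.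
  rewrite -[leRHS](@divfK _ (rnorm y + 1)) ?gt_eqF//.
  by apply: ler_pM; rewrite ?rnorm_ge0// ?lerDl// ltW.
have bw : rnorm (inner (rho D (rho w x')) (y' - y)) <= e / 3.
  apply: le_trans (cauchy_schwarz _ _) _; rewrite !urep_rnorm mulrC.
  rewrite -[leRHS](@divfK _ (rnorm x + 1)) ?gt_eqF//.
  by apply: ler_pM; rewrite ?rnorm_ge0// ?lerDl// ltW.
apply: le_lt_trans (ler_rnormD _ _) _.
have := ler_rnormD (inner (rho D (rho w x)) y) (inner (rho D (rho w (x' - x))) y).
lra.
Qed.

(* Conjugation by [torus i j c] with [c -> 0] spreads the elements
   [transv i j (b k)], however close to the identity they are. *)
Lemma orbit_block (v : H) (X : seq H) (m : nat) (e : R) : (2 <= d)%N -> 0 < e ->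
  exists (th : H) (g : 'I_m -> SL K d),
  [/\ rnorm th = rnorm v,
      forall k, rnorm (rho (g k) th - v) <= e,
      forall k x y, x \in X -> y \in X -> rnorm (inner (rho (g k) x) y) <= e
    & forall k l x y, k != l -> x \in X -> y \in X ->
        rnorm (inner (rho (g k) x) (rho (g l) y)) <= e].
Proof.
move=> d2 e0; pose i := Ordinal (ltnW d2); pose j := Ordinal d2.
have ij : i != j by [].
(* The points are fixed, and distinct, before [c] is chosen: how small [c] has to be depends on the
   differences [b k - b l]. *)
have [b [b_inj bP]] := dnbhs0_points m
  (near_transv rho_cont v ij (@cvg_id _ (nbhs (0 : K))) e0).
have n1 : \forall c \near (0 : K)^', forall k x, x \in X -> forall y, y \in X ->
    rnorm (inner (rho (torus i j c) x) (rho (transv i j (- b k)) y)) < e.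
  apply: filter_forall => k; apply: near_all_mem => x _;
    apply: near_all_mem => y _.
  exact: torus_decay.
(* The quotient of two elements of the block is the transvection with parameter [(b k - b l) / c^2],
   written here as the inverse of a quantity tending to 0 with [c]. *)
have n2 : \forall c \near (0 : K)^', forall k l x, x \in X -> forall y, y \in X ->
    k != l ->
    rnorm (inner (rho (transv i j (c * ((b k - b l)^-1 * c))^-1) x) y) < e.
  apply: filter_forall => k; apply: filter_forall => l.
  apply: near_all_mem => x _; apply: near_all_mem => y _.
  have [->|kl] := eqVneq k l; first exact: nearW.
  have bkl : (b k - b l)^-1 != 0.
    by rewrite invr_eq0 subr_eq0; apply: contra_neq kl; exact: b_inj.
  have := dnbhs0_sqr bkl (transv_decay x y ij e0).
  by apply: filterS => c.
have [c c0 [c1 c2]] := local_field_dnbhs_ex (filterI n1 n2).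
exists (rho (torus i j c)^-1%g v), (fun k => transv i j (b k) * torus i j c)%g.
split.
- by rewrite urep_rnorm.
- by move=> k; rewrite urepM urepVK; exact: ltW.
- move=> k x y xX yX; rewrite urepM urep_adj transvV//.
  exact: ltW (c1 k x xX y yX).
move=> k l x y kl xX yX; rewrite ltW//.
rewrite -urep_inner_quot.
have -> : (transv i j (b k) * torus i j c)%g = (transv i j (b l) * torus i j c *
    transv i j (c * ((b k - b l)^-1 * c))^-1)%g.
  have -> : (c * ((b k - b l)^-1 * c))^-1 =
      (coef i j c 0 i)^-1 * (b k - b l) * coef i j c 0 j.
    by rewrite !mxE eqxx [j == i]eq_sym (negPf ij) eqxx !invfM invrK; ring.
  by rewrite -[RHS]mulgA -transv_torusJ// mulgA transvD// addrC subrK.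
by rewrite mulKg; exact: c2.
Qed.

End OrbitBlock.

(** * Parseval and Bessel systems *)

Section ParsevalSystems.
Variables (R : realType) (H : hilbertType R).
Implicit Types (f x y z e : H) (s : seq H).

Definition expansion s f : H := \sum_(e <- s) inner f e *: e.

Definition coef_energy s f : R := \sum_(e <- s) rnorm (inner f e) ^+ 2.

(** Makes [expansion s] the orthogonal projection onto the span of [s], while allowing zero vectors
    in [s]. *)
Definition projective s :=
  forall f e, e \in s -> inner (f - expansion s f) e = 0.

Lemma expansionB s f z : expansion s (f - z) = expansion s f - expansion s z.
Proof.
rewrite /expansion -sumrB; apply: eq_bigr => e _.
by rewrite innerBl scalerBl.
Qed.

Lemma rnorm_inner_sqr (a b : H) : (rnorm (inner a b) ^+ 2)%:C = inner a b *
  inner b a.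
Proof. by rewrite rmorphXn /= -normr_rnorm sqr_normc (innerC b a). Qed.

Lemma inner_expansion s f : inner (expansion s f) f = (coef_energy s f)%:C.
Proof.
rewrite /expansion /coef_energy inner_suml rmorph_sum; apply: eq_bigr => e _.
by rewrite innerZl; exact/esym/rnorm_inner_sqr.
Qed.

Lemma rnorm_sub_expansion s f : projective s ->
  rnorm (f - expansion s f) ^+ 2 = rnorm f ^+ 2 - coef_energy s f.
Proof.
move=> ps; apply: complexI; rewrite -innerxx innerBr rmorphB /= -innerxx.
rewrite -inner_expansion [inner _ (expansion s f)]inner_sumr big1_seq.
  by rewrite subr0 innerBl.
by move=> e /andP[_ es]; rewrite innerZr ps// mulr0.
Qed.

(** One step of Gram-Schmidt. If [x] already lies in the span, then [r = 0] and [e = 0], so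
    dependent vectors only contribute zeros to the system. *)
Lemma projective_rcons s x : projective s ->
  let r := x - expansion s x in
  let e := (rnorm r)^-1%:C *: r in
  [/\ projective (rcons s e), expansion (rcons s e) x = x, rnorm e <= 1
    & forall z, expansion s z = z -> expansion (rcons s e) z = z].
Proof.
move=> ps r e.
have es y : y \in s -> inner e y = 0.
  by move=> ys; rewrite innerZl ps// mulr0.
have Pe f : inner (expansion s f) e = 0.
  rewrite inner_suml big1_seq// => y /andP[_ ys].
  by rewrite innerZl [inner y e]innerC es// conjc0 mulr0.
have ee_e f : inner f e * inner e e = inner f e.
  have [r0|r0] := eqVneq r 0; first by rewrite /e r0 scaler0 !inner0r mulr0.
  rewrite innerxx rnormZ rnorm_real ger0_norm ?invr_ge0 ?rnorm_ge0//.
  by rewrite mulVf ?rnorm_eq0// expr1n mulr1.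
have exp_rcons f : expansion (rcons s e) f = expansion s f + inner f e *: e.
  by rewrite /expansion -cats1 big_cat big_seq1.
split.
- move=> f y; rewrite mem_rcons inE exp_rcons opprD addrA innerBl innerZl.
  case/predU1P => [->|ys]; first by rewrite innerBl Pe subr0 ee_e subrr.
  by rewrite ps// es// mulr0 subr0.
- have xe : inner x e = (rnorm r)%:C.
    rewrite -(subrK (expansion s x) x) innerDl Pe addr0 -/r innerZr_real innerxx.
    have [->|r0] := eqVneq r 0; first by rewrite rnorm0 expr0n mulr0.
    by rewrite -rmorphM /= expr2 mulKf ?rnorm_eq0.
  rewrite exp_rcons xe /e scalerA -rmorphM /=.
  have [r0|r0] := eqVneq r 0.
    by rewrite r0 scaler0 addr0; apply/esym/eqP; rewrite -subr_eq0 -/r r0.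
  by rewrite divff ?rnorm_eq0// scale1r addrC subrK.
- rewrite rnormZ rnorm_real ger0_norm ?invr_ge0 ?rnorm_ge0//.
  have [->|r0] := eqVneq r 0; first by rewrite rnorm0 mulr0.
  by rewrite mulVf ?rnorm_eq0.
move=> z Pz; have := Pe z; rewrite exp_rcons Pz => ->.
by rewrite scale0r addr0.
Qed.

Lemma countable_enum (T : choiceType) (t0 : T) (D : set T) : countable D ->
  exists u : nat -> T, forall t, D t -> exists n, u n = t.
Proof.
move=> /countable_injP[f f_inj].
exists (fun n => xget t0 [set t | D t /\ f t = n]) => t Dt; exists (f t).
have [|Dy fy] := @xgetPex _ t0 [set y | D y /\ f y = f t]; first by exists t.
by apply: f_inj; rewrite ?inE.
Qed.

(** Gram-Schmidt applied to a dense sequence: [expansion] fixes the terms already treated, so the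
    residue of [f] is that of [f - y] for a dense [y] near [f]. *)
Lemma parseval_system : separable H ->
  exists (e : nat -> H), [/\ forall n, rnorm (e n) <= 1,
    forall f n, coef_energy (mkseq e n) f <= rnorm f ^+ 2
  & forall f (dl : R), 0 < dl ->
      exists n, rnorm f ^+ 2 - dl < coef_energy (mkseq e n) f].
Proof.
move=> [D cD dD]; have [u uD] := countable_enum 0 cD.
pose next s n := let r := u n - expansion s (u n) in (rnorm r)^-1%:C *: r.
pose es := fix es n := if n is m.+1 then rcons (es m) (next (es m) m) else [::].
pose e n := next (es n) n.
have esE n : es n = mkseq e n.
  by elim: n => //= n {1}->; rewrite -mkseqS.
have ps n : projective (es n).
  by elim: n => [//|n IH]; have [] := projective_rcons (u n) IH.
have fixu n k : (k < n)%N -> expansion (es n) (u k) = u k.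
  elim: n => [//|n IH]; have [_ un _ keep] := projective_rcons (u n) (ps n).
  by rewrite ltnS leq_eqVlt => /predU1P[->//|kn]; apply: keep; exact: IH.
exists e; split.
- by move=> n; have [] := projective_rcons (u n) (ps n).
- by move=> f n; rewrite -esE -subr_ge0 -rnorm_sub_expansion// sqr_ge0.
move=> f dl dl0.
(* A distance below both 1 and [dl] has its square below [dl]. *)
pose t := Num.min 1 dl.
have t0 : 0 < t by rewrite lt_min ltr01.
have nO : nbhs f [set y | rnorm (f - y) < t] by apply/nbhs_rnormP; exists t.
have [||y [/interior_subset fy Dy]] := dD ([set y | rnorm (f - y) < t]°).
- by exists f.
- exact: open_interior.
have [n un] := uD y Dy; exists n.+1.
rewrite ltrBlDr -ltrBlDl -esE -rnorm_sub_expansion//.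
have -> : f - expansion (es n.+1) f = (f - y) - expansion (es n.+1) (f - y).
  by rewrite expansionB -un fixu// opprB subrKA.
rewrite rnorm_sub_expansion//.
have : 0 <= coef_energy (es n.+1) (f - y).
  by apply: sumr_ge0 => x _; rewrite sqr_ge0.
have := rnorm_ge0 (f - y).
have : rnorm (f - y) < 1 /\ rnorm (f - y) < dl by apply/andP; rewrite -lt_min.
nra.
Qed.

(** [k] bounds the squared norm of the synthesis operator of [s]. Coefficients are paired with
    positions, since a vector may occur several times. *)
Definition synthesis_bound (s : seq H) (k : R) :=
  forall t : seq (R[i] * H), unzip2 t = s ->
    rnorm (\sum_(p <- t) p.1 *: p.2) ^+ 2 <= k * \sum_(p <- t) rnorm p.1 ^+ 2.

(** Duality: with [S] the energy of [f], [S = inner (expansion s f) f] gives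
    [S^2 <= k * S * rnorm f ^+ 2]. *)
Lemma synthesis_bessel s k f : 0 <= k -> synthesis_bound s k ->
  coef_energy s f <= k * rnorm f ^+ 2.
Proof.
move=> k0 syn; set S := coef_energy s f.
have S0 : 0 <= S by apply: sumr_ge0 => x _; rewrite sqr_ge0.
have ts : unzip2 [seq (inner f x, x) | x <- s] = s.
  by rewrite /unzip2 -map_comp; exact: map_id.
have := syn _ ts; rewrite !big_map /= -/(expansion s f) -/S => bS.
have := cauchy_schwarz (expansion s f) f.
rewrite inner_expansion -/S rnorm_real ger0_norm// => SC.
have [->|Sn0] := eqVneq S 0; first by rewrite mulr_ge0 ?sqr_ge0.
have Sp : 0 < S by rewrite lt_def Sn0.
rewrite -(ler_pM2l Sp); apply: (@le_trans _ _ ((rnorm (expansion s f) * rnorm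
  f) ^+ 2)).
  by rewrite -expr2; apply: lerXn2r; rewrite ?nnegrE// mulr_ge0 ?rnorm_ge0.
by rewrite exprMn [leRHS]mulrA ler_wpM2r ?sqr_ge0// mulrC.
Qed.

(** The squared norm of [x] is absorbed by [k] and not added to it; only the cross terms, split by
    [2 p q <= p^2 + q^2], increase the bound. *)
Lemma synthesis_rcons s x k dl : 0 <= dl -> rnorm x ^+ 2 <= k ->
  (forall y, y \in s -> rnorm (inner y x) <= dl) ->
  synthesis_bound s k ->
  synthesis_bound (rcons s x) (k + dl * (size s).+1%:R).
Proof.
move=> dl0 xk sx syn t; case/lastP: t => [|t [b y]].
  by move=> /(congr1 size); rewrite size_rcons.
rewrite /unzip2 map_rcons => /rcons_inj[ts /= yx]; subst y.
rewrite -cats1 !big_cat !big_seq1 /=; set v := \sum_(p <- t) _.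
set A := \sum_(p <- t) _.
have vA : rnorm v ^+ 2 <= k * A by exact: syn.
have A0 : 0 <= A by apply: sumr_ge0 => p _; rewrite sqr_ge0.
have cross : complex.Re (inner v (b *: x)) *+ 2 <=
    dl * A + dl * (size s)%:R * rnorm b ^+ 2.
  apply: (@le_trans _ _ (\sum_(p <- t) (dl * rnorm p.1 ^+ 2 + dl * rnorm b ^+
    2))).
    apply: (@le_trans _ _ (rnorm (inner v (b *: x)) *+ 2)).
      by rewrite lerMn2r ler_Re_rnorm orbT.
    rewrite inner_suml; apply: (@le_trans _ _ ((\sum_(p <- t) rnorm (inner (p.1
      *: p.2) (b *: x))) *+ 2)).
      by rewrite lerMn2r ler_rnorm_sum orbT.
    rewrite -sumrMnl big_seq [leRHS]big_seq; apply: ler_sum => -[a y] pt /=.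
    have ys : y \in s by rewrite -ts; apply/mapP; exists (a, y).
    rewrite innerZl rnormM rnorm_innerZr.
    have := sx y ys; have := rnorm_ge0 a; have := rnorm_ge0 b.
    move: (rnorm (inner y x)) (rnorm a) (rnorm b) => r p q q0 p0 rd.
    have := ler_wpM2l (mulr_ge0 p0 q0) rd; rewrite -mulrA.
    have : 0 <= dl * (p - q) ^+ 2 by rewrite mulr_ge0 ?sqr_ge0.
    rewrite sqrrB; nra.
  rewrite big_split /= -mulr_sumr -/A lerD2l big_const_seq count_predT.
  by rewrite iter_addr_0 -ts size_map -[leLHS]mulr_natl mulrCA mulrA.
rewrite rnorm_sqrD rnormZ exprMn.
have B0 := sqr_ge0 (rnorm b).
have sA : 0 <= (size s)%:R * dl * A by rewrite !mulr_ge0.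
have : rnorm b ^+ 2 * rnorm x ^+ 2 <= rnorm b ^+ 2 * k by rewrite ler_wpM2l.
have : 0 <= dl * rnorm b ^+ 2 by rewrite mulr_ge0.
have -> : (k + dl * (size s).+1%:R) * (A + rnorm b ^+ 2) =
    k * A + (dl * A + dl * (size s)%:R * rnorm b ^+ 2) + rnorm b ^+ 2 * k +
    (size s)%:R * dl * A + dl * rnorm b ^+ 2 by rewrite -natr1; ring.
by move=> q0 bk; have := lerD (lerD vA cross) bk; lra.
Qed.

(** [T] bounds all intermediate lengths, so each new vector costs at most [dl * T], and [dl] can be
    chosen in advance. *)
Lemma synthesis_cat s u k dl (T : nat) : 0 <= dl ->
  (size (s ++ u) <= T)%N -> (forall x, x \in u -> rnorm x ^+ 2 <= k) ->
  (forall x y, x \in s -> y \in u -> rnorm (inner x y) <= dl) ->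
  pairwise (fun x y => rnorm (inner x y) <= dl) u ->
  synthesis_bound s k ->
  synthesis_bound (s ++ u) (k + dl * T%:R * (size u)%:R).
Proof.
move=> dl0; elim/last_ind: u => [|u x IH] sT uk su pu syn.
  by rewrite cats0 mulr0 addr0.
rewrite -rcons_cat size_rcons.
have sT' : (size (s ++ u) < T)%N by move: sT; rewrite !size_cat size_rcons addnS.
move: pu; rewrite pairwise_rcons => /andP[/allP ux pu].
have {}IH : synthesis_bound (s ++ u) (k + dl * T%:R * (size u)%:R).
  apply: IH => //; first exact: ltnW.
    by move=> y yu; apply: uk; rewrite mem_rcons inE yu orbT.
  by move=> y z ys zu; apply: su; rewrite // mem_rcons inE zu orbT.
have step := synthesis_rcons dl0 _ _ IH.
move=> t tsu; apply: le_trans (step _ _ _ t tsu) _.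
- apply: le_trans (uk x _) _; first by rewrite mem_rcons mem_head.
  by rewrite lerDl !mulr_ge0.
- move=> y; rewrite mem_cat => /orP[ys|/ux//].
  by apply: su; rewrite // mem_rcons mem_head.
apply: ler_wpM2r; first by apply: sumr_ge0 => p _; rewrite sqr_ge0.
rewrite -addrA lerD2l -[(size u).+1%:R]natr1 mulrDr mulr1 lerD2l ler_wpM2l//
  ler_nat.
exact: sT'.
Qed.

End ParsevalSystems.

(** * Construction of the orbit *)

Section Construction.
Variables (G : preTopologicalGroupType) (R : realType) (H : hilbertType R).
Variable rho : unitary_rep G H.

(** The conclusion of [orbit_block]: all that the construction takes from the special linear
    group. *)
Definition spreading := forall (v : H) (X : seq H) (m : nat) (e : R), 0 < e ->
  exists (th : H) (g : 'I_m -> G),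
  [/\ rnorm th = rnorm v,
      forall k, rnorm (rho (g k) th - v) <= e,
      forall k x y, x \in X -> y \in X -> rnorm (inner (rho (g k) x) y) <= e
    & forall k l x y, k != l -> x \in X -> y \in X ->
        rnorm (inner (rho (g k) x) (rho (g l) y)) <= e].

Variables (psi : H) (e : nat -> H) (eta : R).
Hypotheses (rho_spread : spreading) (psi0 : psi != 0) (eta0 : 0 < eta).
Hypothesis e1 : forall n, rnorm (e n) <= 1.

(* An entry [(g, (a, w))] records a group element [g] with the intended main
   part [a] and the nearly orthogonal part [w] of [rho g phi]. *)
Local Notation entry := (G * (H * H))%type.
Implicit Types (l : seq entry) (p : entry) (f : H) (ph : H).

Definition main_part p : H := p.2.1.
Definition stray_part p : H := p.2.2.

(** Elements of one coset of the projective kernel would give [rnorm psi ^+ 2]; the factor 1/2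
    leaves a margin for nearby cosets. *)
Definition orbit_separated : rel entry := fun p q =>
  rnorm (inner (rho p.1 psi) (rho q.1 psi)) <= rnorm psi ^+ 2 / 2.

Local Notation h n := (2^-1 ^+ n : R).

Lemma exp_half_gt0 n : 0 < h n.
Proof. by rewrite exprn_gt0 ?invr_gt0. Qed.

Lemma exp_halfS n : h n = h n.+1 + h n.+1.
Proof. by rewrite exprS; field. Qed.

Lemma exp_half_le1 n : h n <= 1.
Proof. by rewrite exprn_ile1 ?invr_ge0// invf_le1// ler1n. Qed.

(** The powers of 1/2 make the errors summable over the steps, and dividing by the length protects
    all entries already present. The third item is asked for every [ph2] near [ph'] so that it
    applies to the limit. *)
Definition step_spec n l ph (blk : seq entry) ph' :=
  [/\ forall f, \sum_(p <- blk) rnorm (inner f (main_part p)) ^+ 2 =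
        rnorm (inner f (e n)) ^+ 2,
      rnorm (ph' - ph) <= h n.+1 * eta / (size l).+1%:R,
      forall ph2, rnorm (ph2 - ph') <= h n.+1 * eta / (size (l ++ blk)).+1%:R ->
        \sum_(p <- blk) rnorm (rho p.1 ph2 - main_part p - stray_part p) ^+ 2
          <= h n * eta ^+ 2,
      forall k, eta ^+ 2 <= k -> rnorm ph <= eta ->
        synthesis_bound (map stray_part l) k ->
        synthesis_bound (map stray_part (l ++ blk)) (k + h n.+1 * eta ^+ 2)
    & pairwise orbit_separated l -> pairwise orbit_separated (l ++ blk)].

Lemma step_exists n l ph : exists blk ph', step_spec n l ph blk ph'.
Proof.
have he0 : 0 < h n.+1 * eta by rewrite mulr_gt0 ?exp_half_gt0.
have [M Mlt] := @exists_inv_lt R (h n.+1 * eta / (size l).+1%:R)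
  (divr_gt0 he0 (ltr0Sn _ _)).
(* [c = m^(-1/2)]: the [m] vectors [c e_n] carry the energy of [e_n], while [ph] moves by at most
   [c]. *)
pose c : R := M.+1%:R^-1; pose m := (M.+1 ^ 2)%N.
have c0 : 0 < c by rewrite invr_gt0 ltr0Sn.
have mc : m%:R * c ^+ 2 = 1.
  by rewrite natrX -exprMn divff ?expr1n// pnatr_eq0.
have m0 : 0 < m%:R :> R by rewrite ltr0n expn_gt0.
pose T := (size l + m)%N.
have T0 : 0 < T%:R :> R by rewrite ltr0n addn_gt0 expn_gt0 orbT.
have Tm0 : 0 < T%:R * m%:R :> R by rewrite mulr_gt0.
(* In this order: closeness to [e n], separation of the orbit of [psi], and growth of the synthesis
   bound. *)
pose dl := Num.min (h n.+1 * eta)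
  (Num.min (rnorm psi ^+ 2 / 2) (h n.+1 * eta ^+ 2 / (T%:R * m%:R))).
have dl0 : 0 < dl.
  rewrite !lt_min he0 /= !divr_gt0 ?exprn_gt0 ?rnorm_gt0//.
  by rewrite mulr_gt0 ?exp_half_gt0 ?exprn_gt0.
have dl1 : dl <= h n.+1 * eta by rewrite ge_min lexx.
have dl2 : dl <= rnorm psi ^+ 2 / 2 by rewrite !ge_min lexx !orbT.
have dl3 : dl * T%:R * m%:R <= h n.+1 * eta ^+ 2.
  by rewrite -mulrA -ler_pdivlMr// !ge_min lexx !orbT.
(* The new stray parts are images of [ph], to be compared with each other and with the old ones;
   likewise for the images of [psi]. *)
pose X := ph :: psi :: map stray_part l ++ [seq rho p.1 psi | p <- l].
have [th [g [thn gth gX ggX]]] := rho_spread (e n) X m dl0.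
have phX : ph \in X by rewrite inE eqxx.
have psiX : psi \in X by rewrite !inE eqxx orbT.
have strayX p : p \in l -> stray_part p \in X.
  by move=> pl; rewrite !inE mem_cat map_f ?orbT.
have movedX p : p \in l -> rho p.1 psi \in X.
  move=> pl; have := map_f (fun p => rho p.1 psi) pl.
  by rewrite !inE mem_cat => ->; rewrite !orbT.
pose blk : seq entry := [seq (g i, (c%:C *: e n, rho (g i) ph)) | i <- enum 'I_m].
pose ph' := ph + c%:C *: th.
have sblk : size blk = m by rewrite size_map size_enum_ord.
have pw (r : rel 'I_m) : (forall i j, i != j -> r i j) -> pairwise r (enum 'I_m).
  move=> rne; apply: (@sub_pairwise _ (fun i j => i != j)) => [i j|].
    exact: rne.
  by rewrite -uniq_pairwise enum_uniq.
exists blk, ph'; split.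
- move=> f; rewrite big_map big_enum /main_part /= sumr_const card_ord
    rnorm_innerZr.
  rewrite rnorm_real gtr0_norm// exprMn -mulr_natl mulrA mc mul1r.
  by [].
- rewrite addrC addKr rnormZ rnorm_real gtr0_norm// thn.
  by apply: le_trans _ (ltW Mlt); rewrite -[leRHS]mulr1 ler_wpM2l ?(ltW c0).
- move=> ph2 near2; rewrite big_map big_enum /main_part /stray_part /=.
  have bnd i : rnorm (rho (g i) ph2 - c%:C *: e n - rho (g i) ph) <= c * (h n *
    eta).
    have -> : rho (g i) ph2 - c%:C *: e n - rho (g i) ph =
        rho (g i) (ph2 - ph') + c%:C *: (rho (g i) th - e n).
      rewrite /ph' opprD addrA !urepB urepZ scalerBr addrA subrK.
      by rewrite addrAC.
    apply: le_trans (ler_rnormD _ _) _; rewrite urep_rnorm rnormZ rnorm_real.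
    rewrite gtr0_norm//.
    have b1 : c * rnorm (rho (g i) th - e n) <= c * (h n.+1 * eta).
      by rewrite ler_wpM2l ?(ltW c0)// (le_trans (gth i)).
    (* The tolerance on [ph2] divides by more than the [m] elements of the block, and [m] is at
       least [M.+1], so it yields the factor [c] whose square, summed [m] times, is 1. *)
    have b2 : h n.+1 * eta / (size (l ++ blk)).+1%:R <= c * (h n.+1 * eta).
      rewrite mulrC; apply: ler_wpM2r; first exact: ltW.
      rewrite /c lef_pV2 ?posrE ?ltr0Sn// ler_nat ltnS.
      rewrite size_cat sblk; apply: leq_trans (leq_addl _ _).
      by apply: leq_trans (leqnSn M) _; rewrite /m expnS leq_pmulr// expn_gt0.
    rewrite (exp_halfS n) mulrDl mulrDr; apply: lerD => //.
    exact: le_trans near2 b2.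
  apply: (@le_trans _ _ (\sum_(i < m) (c * (h n * eta)) ^+ 2)).
    apply: ler_sum => i _; apply: lerXn2r; rewrite ?nnegrE ?rnorm_ge0 ?bnd//.
    by rewrite !mulr_ge0 ?ltW// exp_half_gt0.
  rewrite sumr_const card_ord exprMn -[leLHS]mulr_natl mulrA mc mul1r exprMn.
  apply: ler_wpM2r; first exact: sqr_ge0.
  rewrite expr2 -[leRHS]mulr1; apply: ler_wpM2l; last exact: exp_half_le1.
  exact: ltW (exp_half_gt0 n).
- move=> k k_eta ph_eta syn t; rewrite map_cat => ts.
  have su : size (map stray_part blk) = m by rewrite size_map sblk.
  have step := @synthesis_cat R H (map stray_part l) (map stray_part blk) k dl
    T (ltW dl0).
  apply: (le_trans (step _ _ _ _ syn t ts)).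
  + by rewrite size_cat su size_map.
  + move=> x /mapP[p /mapP[i _ ->] ->] /=; rewrite urep_rnorm.
    by apply: le_trans _ k_eta; apply: lerXn2r;
      rewrite ?nnegrE ?rnorm_ge0 ?(ltW eta0).
  + move=> x y /mapP[p pl ->] /mapP[q /mapP[i _ ->] ->] /=.
    by rewrite rnorm_innerC gX// strayX.
  + by rewrite -map_comp pairwise_map; apply: pw => i j ij /=; exact: ggX.
  apply: ler_wpM2r; first by apply: sumr_ge0 => p _; rewrite sqr_ge0.
  by rewrite lerD2l su.
move=> sl; rewrite pairwise_cat sl /= pairwise_map; apply/andP; split.
  apply/allrelP => p q pl /mapP[i _ ->] /=; rewrite /orbit_separated /=.
  by rewrite rnorm_innerC (le_trans _ dl2)// gX// movedX.
by apply: pw => i j ij; rewrite /orbit_separated /= (le_trans _ dl2)// ggX.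
Qed.

Definition rest_part (phi : H) (p : entry) : H :=
  rho p.1 phi - main_part p - stray_part p.

Lemma exp_half_lt (x : R) : 0 < x -> exists n, h n < x.
Proof.
move=> /exists_inv_lt[n nx]; exists n; apply: le_lt_trans nx.
rewrite exprVn lef_pV2 ?posrE ?exprn_gt0// ?ltr0Sn//.
by rewrite -natrX ler_nat ltn_expl.
Qed.

Lemma synthesis_bound_le (s : seq H) (k k' : R) : k <= k' ->
  synthesis_bound s k -> synthesis_bound s k'.
Proof.
move=> kk syn t ts; apply: le_trans (syn t ts) _; apply: ler_wpM2r => //.
by apply: sumr_ge0 => p _; rewrite sqr_ge0.
Qed.

Lemma orbit_limit : exists (phi : H) (L : nat -> seq entry),
  [/\ forall n, exists blk, L n.+1 = L n ++ blk,
      forall n f, \sum_(p <- L n) rnorm (inner f (main_part p)) ^+ 2 =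
        coef_energy (mkseq e n) f,
      forall n, \sum_(p <- L n) rnorm (rest_part phi p) ^+ 2
        <= 2 * eta ^+ 2,
      forall n, synthesis_bound (map stray_part (L n)) (2 * eta ^+ 2)
    & forall n, pairwise (orbit_separated) (L n)].
Proof.
have stepP (x : nat * (seq entry * H)) : exists y : seq entry * H,
    step_spec x.1 x.2.1 x.2.2 y.1 y.2.
  have [blk [ph' sp]] := step_exists x.1 x.2.1 x.2.2.
  by exists (blk, ph').
have [F FP] := choice stepP.
pose st := fix st n : seq entry * H :=
  if n is m.+1 then ((st m).1 ++ (F (m, st m)).1, (F (m, st m)).2) else ([::], 0).
pose L n := (st n).1; pose ph n := (st n).2.
have sp n : step_spec n (L n) (ph n) (F (n, st n)).1 (ph n.+1).
  exact: FP (n, st n).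
have LS n : L n.+1 = L n ++ (F (n, st n)).1 by [].
have heta0 n : 0 < h n * eta by rewrite mulr_gt0 ?exp_half_gt0.
have inv1 k : k.+1%:R^-1 <= 1 :> R by rewrite invf_le1 ?ltr0Sn// ler1n.
have phn n : rnorm (ph n) <= eta * (1 - h n).
  elim: n => [|n IH]; first by rewrite rnorm0 expr0 subrr mulr0.
  have [_ d _ _ _] := sp n; have := ler_rnormD (ph n) (ph n.+1 - ph n).
  rewrite addrC subrK => tri.
  have {}d : rnorm (ph n.+1 - ph n) <= h n.+1 * eta.
    by apply: le_trans d _; rewrite -[leRHS]mulr1 ler_wpM2l// ltW.
  have := exp_halfS n; move: (h n) (h n.+1) IH d => a b IH d ab.
  by move: IH; rewrite ab; lra.
have phn1 n : rnorm (ph n) <= eta.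
  apply: le_trans (phn n) _; rewrite -[leRHS]mulr1 ler_wpM2l ?(ltW eta0)//.
  by rewrite gerBl ltW// exp_half_gt0.
have sizeL n m : (n <= m)%N -> (size (L n) <= size (L m))%N.
  elim: m => [|m IH]; first by rewrite leqn0 => /eqP->.
  rewrite leq_eqVlt => /predU1P[->//|nm]; apply: leq_trans (IH nm) _.
  by rewrite LS size_cat leq_addr.
have dist n m : (n <= m)%N ->
    rnorm (ph m - ph n) <= (h n - h m) * eta / (size (L n)).+1%:R.
  elim: m => [|m IH]; first by rewrite leqn0 => /eqP->;
    rewrite !subrr rnorm0 !mul0r.
  rewrite leq_eqVlt => /predU1P[->|nm]; first by rewrite !subrr rnorm0 !mul0r.
  have [_ d _ _ _] := sp m; rewrite -(subrKA (ph m)).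
  apply: le_trans (ler_rnormD _ _) _.
  have d' : rnorm (ph m.+1 - ph m) <= h m.+1 * eta / (size (L n)).+1%:R.
    apply: le_trans d _; rewrite ler_wpM2l ?(ltW (heta0 _))//.
    by rewrite lef_pV2 ?posrE ?ltr0Sn// ler_nat ltnS sizeL.
  apply: le_trans (lerD d' (IH nm)) _; rewrite -!mulrDl.
  by rewrite (exp_halfS m) opprD addrCA addNKr.
have [phi phiP] : exists phi, forall x : R, 0 < x -> exists N : nat, forall n :
  nat,
    (N <= n)%N -> rnorm (phi - ph n) < x.
  apply: rnorm_cauchy_lim => x x0.
  have [|N Nx] := @exp_half_lt (x / 2 / eta); first by rewrite !divr_gt0.
  have near n : (N <= n)%N -> rnorm (ph n - ph N) < x / 2.
    move=> Nn; apply: le_lt_trans (dist _ _ Nn) _.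
    apply: (@le_lt_trans _ _ (h N * eta)); last by rewrite -ltr_pdivlMr.
    rewrite -[leRHS]mulr1; apply: ler_pM => //.
    + rewrite mulr_ge0 ?(ltW eta0)// subr_ge0.
      by rewrite ler_wiXn2l ?invr_ge0// (exp_half_le1 1).
    + by rewrite invr_ge0.
    rewrite ler_wpM2r ?(ltW eta0)//.
    by rewrite gerBl ltW// exp_half_gt0.
  exists N => m n Nm Nn; rewrite -(subrKA (ph N)) (splitr x).
  apply: le_lt_trans (ler_rnormD _ _) _; apply: ltrD; first exact: near.
  by rewrite rdistrC; exact: near.
have lim n : rnorm (phi - ph n) <= h n * eta / (size (L n)).+1%:R.
  apply/ler_addgt0Pr => x x0; have [N NP] := phiP x x0.
  pose m := maxn n N; have nm : (n <= m)%N by exact: leq_maxl.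
  rewrite -(subrKA (ph m)) addrC.
  apply: le_trans (ler_rnormD _ _) _; apply: lerD; last first.
    by apply/ltW/NP; exact: leq_maxr.
  apply: le_trans (dist _ _ nm) _; rewrite ler_wpM2r ?invr_ge0//.
  by rewrite ler_wpM2r ?(ltW eta0)// gerBl ltW// exp_half_gt0.
exists phi, L; split.
- by move=> n; exists (F (n, st n)).1.
- move=> n f; elim: n => [|n IH]; first by rewrite /coef_energy !big_nil.
  rewrite LS big_cat /= IH; have [-> _ _ _ _] := sp n.
  by rewrite mkseqS /coef_energy -cats1 big_cat big_seq1.
(* The contributions [h n] of the steps add up to [2 - 2 * h n]. *)
- have bnd n : \sum_(p <- L n)
      rnorm (rest_part phi p) ^+ 2 <= (2 - 2 * h n) * eta ^+ 2.
    elim: n => [|n IH]; first by rewrite big_nil expr0 mulr1 subrr mul0r.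
    rewrite LS big_cat /=; have [_ _ d _ _] := sp n.
    have {}d : \sum_(p <- (F (n, st n)).1) rnorm (rest_part phi p) ^+ 2 <=
        h n * eta ^+ 2 by exact: d phi (lim n.+1).
    have := exp_halfS n; move: (h n) (h n.+1) IH d => a b IH d ab.
    by move: IH d; rewrite ab; lra.
  move=> n; apply: le_trans (bnd n) _; rewrite ler_wpM2r ?sqr_ge0//.
  by rewrite gerBl mulr_ge0// ltW// exp_half_gt0.
(* At [n = 0] this is [eta ^+ 2] although the list is empty, because a step requires
   [eta ^+ 2 <= k]; the increments [h n.+1] then add up to less than 1. *)
- have bnd n : synthesis_bound (map stray_part (L n)) ((2 - h n) * eta ^+ 2).
    elim: n => [|n IH].
      move=> [|//] _; rewrite !big_nil rnorm0 expr0n mulr0 //.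
    rewrite LS; have [_ _ _ syn _] := sp n.
    have ge : eta ^+ 2 <= (2 - h n) * eta ^+ 2.
      rewrite -[leLHS]mul1r ler_wpM2r ?sqr_ge0//.
      by have := exp_half_le1 n; lra.
    apply: synthesis_bound_le (syn _ ge (phn1 n) IH).
    by have := exp_halfS n; move: (h n) (h n.+1) => a b ->; lra.
  move=> n; apply: synthesis_bound_le (bnd n); rewrite ler_wpM2r ?sqr_ge0//.
  by rewrite gerBl ltW// exp_half_gt0.
elim=> [//|n IH]; rewrite LS; have [_ _ _ _ sep] := sp n; exact: sep.
Qed.
End Construction.

(** * Quotient by the projective kernel *)

Section ProjectiveKernelTopology.
Variables (G : preTopologicalGroupType) (R : realType) (H : hilbertType R).
Variable rho : unitary_rep G H.
Implicit Types (g h c : G) (v w : H).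

(** Equality in Cauchy-Schwarz makes every vector an eigenvector. Preservation of the inner product
    forces equal eigenvalues for non-orthogonal vectors, and a [v] orthogonal to [x0] is compared
    through [v + x0]. *)
Lemma pker_normP g : (forall v, rnorm (inner (rho g v) v) = rnorm v ^+ 2) ->
  pker_set rho g.
Proof.
move=> gn.
have eig v : exists2 z, `|z| = 1 & rho g v = z *: v.
  have [->|v0] := eqVneq v 0; first by exists 1; rewrite ?normr1// urep0 scaler0.
  have nv0 : rnorm v ^+ 2 != 0 by rewrite sqrf_eq0 rnorm_eq0.
  pose z := inner (rho g v) v / (rnorm v ^+ 2)%:C.
  have zv : inner (rho g v) v = z * (rnorm v ^+ 2)%:C.
    by rewrite divfK// (inj_eq (@complexI R) _ 0).
  have rz : rnorm z = 1.
    apply: (mulIf nv0); rewrite mul1r; have := gn v.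
    by rewrite zv rnormM rnorm_real ger0_norm// sqr_ge0.
  exists z; first by rewrite normr_rnorm rz.
  apply/eqP; rewrite -subr_eq0 -rnorm_eq0 -sqrf_eq0 rnorm_sqrB urep_rnorm.
  have -> : complex.Re (inner (rho g v) (z *: v)) = rnorm v ^+ 2.
    rewrite innerZr zv mulrA (mulrC _^*) -sqr_normc normr_rnorm rz expr1n mul1r.
    by [].
  by rewrite rnormZ rz mul1r mulr2n opprD addrA subrr sub0r addNr.
have [[x0 x00]|all0] := pselect (exists x : H, x != 0); last first.
  exists 1 => [|x]; first exact: normr1.
  have -> : x = 0 by apply/eqP/negPn/negP => x0; apply: all0; exists x.
  by rewrite urep0 scaler0.
have [z z1 gx0] := eig x0; exists z => // .
have nz : forall v, inner v x0 != 0 -> rho g v = z *: v.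
  move=> v vx0; have [z' z'1 gv] := eig v; rewrite gv; congr (_ *: _).
  have := urep_inner rho g v x0; rewrite gv gx0 innerZl innerZr mulrA => eq1.
  have {eq1} : z' * z^*%C = 1 by apply: (mulIf vx0); rewrite mul1r.
  have zz : z * z^*%C = 1 by rewrite -sqr_normc z1 expr1n.
  have z0 : z^*%C != 0.
    by apply/eqP => z0; move: zz; rewrite z0 mulr0 => /esym/eqP; rewrite oner_eq0.
  by move=> z'z; apply: (mulIf z0); rewrite z'z zz.
move=> v; have [vx0|vx0] := eqVneq (inner v x0) 0; last exact: nz.
have /nz : inner (v + x0) x0 != 0.
  by rewrite innerDl vx0 add0r innerxx (inj_eq (@complexI R) _ 0) sqrf_eq0
    rnorm_eq0.
by rewrite urepD scalerDr gx0 => /addIr.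
Qed.

Lemma pker_norm g v : pker_set rho g -> rnorm (inner (rho g v) v) = rnorm v ^+ 2.
Proof.
move=> [z z1 gz]; rewrite gz innerZl rnormM [rnorm z]/rnorm z1 /= mul1r.
by rewrite innerxx rnorm_real ger0_norm// sqr_ge0.
Qed.

Lemma same_coset_inner g g' h h' v :
  quotient_map (pker rho) g = quotient_map (pker rho) g' ->
  quotient_map (pker rho) h = quotient_map (pker rho) h' ->
  rnorm (inner (rho g v) (rho h v)) = rnorm (inner (rho g' v) (rho h' v)).
Proof.
have coset a b : quotient_map (pker rho) a = quotient_map (pker rho) b ->
    exists2 z : R[i], rnorm z = 1 & forall x, rho b x = z *: rho a x.
  move=> /quotient_map_eq[z z1 zab]; exists z; first by rewrite /rnorm z1.
  by move=> x; rewrite -[b](mulVKg a) urepM zab urepZ.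
move=> /coset[z z1 zg] /coset[t t1 th].
by rewrite zg th innerZl rnormM rnorm_innerZr z1 t1 !mul1r.
Qed.

Hypothesis rho_cont : strongly_continuous rho.

Lemma near_rep g v (e : R) : 0 < e ->
  \forall h \near g, rnorm (rho g v - rho h v) < e.
Proof.
by move=> e0; have /cvg_rnormP /(_ e e0) := @rho_cont v g.
Qed.

(** If [c^-1 * g] is outside the kernel, some [v] gives it a coefficient of modulus other than
    [rnorm v ^+ 2]. Strong continuity keeps this true near [(c, g)], and compactness of [C] yields
    one neighborhood of [g] for all [c]. *)
Lemma pker_saturation_closed (C : set G) : compact C ->
  closed (quotient_map (pker rho) @` C).
Proof.
move=> /compact_near_coveringP Ccov; rewrite -openC.
suff : open [set g | forall c, C c -> ~ pker_set rho (c^-1 * g)%g].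
  rewrite [X in open X -> _](_ : _ =
      quotient_map (pker rho) @^-1` (~` (quotient_map (pker rho) @` C))) => [//|].
  apply/seteqP; split => [g gC [c Cc /quotient_map_eq cg]|g gC c Cc cg].
    exact: gC cg.
  by apply: gC; exists c => //; exact/quotient_map_eq.
rewrite openE => g gC.
apply: (Ccov G (nbhs g) (fun g' c => ~ pker_set rho (c^-1 * g')%g)) => c Cc.
have [v vP] : exists v, rnorm (inner (rho g v) (rho c v)) != rnorm v ^+ 2.
  apply: contrapT => nv; apply: (gC c Cc); apply: pker_normP => v.
  by rewrite urep_inner_quot; apply/eqP/negPn/negP => vP; apply: nv; exists v.
pose e := `|rnorm (inner (rho g v) (rho c v)) - rnorm v ^+ 2|.
have e0 : 0 < e by rewrite normr_gt0 subr_eq0.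
have v1 : 0 < rnorm v + 1 by rewrite ltr_wpDl ?rnorm_ge0.
have e2 : 0 < e / 2 / (rnorm v + 1) by rewrite !divr_gt0.
exists ([set c' | rnorm (rho c v - rho c' v) < e / 2 / (rnorm v + 1)],
        [set g' | rnorm (rho g v - rho g' v) < e / 2 / (rnorm v + 1)]).
  by split; exact: near_rep.
move=> [c' g'] [/= cc' gg'] /(pker_norm v).
rewrite urep_inner_quot => eq1.
have small x y : rnorm x < e / 2 / (rnorm v + 1) -> rnorm y = rnorm v ->
    rnorm x * rnorm y < e / 2.
  move=> xe ->; apply: (@le_lt_trans _ _ (rnorm x * (rnorm v + 1))).
    by rewrite ler_wpM2l ?rnorm_ge0// lerDl.
  by rewrite -ltr_pdivlMr.
have : e < e / 2 + e / 2; last by rewrite -splitr ltxx.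
apply: (@le_lt_trans _ _
  (rnorm (inner (rho g v) (rho c v) - inner (rho g' v) (rho c' v)))).
  rewrite /e -eq1 ler_norml ler_rnormB andbT lerNl opprB.
  by rewrite rdistrC ler_rnormB.
have -> : inner (rho g v) (rho c v) - inner (rho g' v) (rho c' v) =
   inner (rho g v - rho g' v) (rho c v) + inner (rho g' v) (rho c v - rho c' v).
  by rewrite innerBl innerBr; ring.
apply: le_lt_trans (ler_rnormD _ _) _; apply: ltrD.
  by apply: le_lt_trans (cauchy_schwarz _ _) _; rewrite small// urep_rnorm.
by apply: le_lt_trans (cauchy_schwarz _ _) _; rewrite mulrC small// urep_rnorm.
Qed.

End ProjectiveKernelTopology.

Section QuotientNeighborhoods.
Variables (G : preTopologicalGroupType) (N : normal_subgroup G).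
Hypothesis mulr_cont : forall h : G, continuous (fun g : G => (g * h)%g).

(** The saturation of [O] is a union of right translates of [O]. *)
Lemma quotient_map_open (O : set G) : open O -> open (quotient_map N @` O).
Proof.
move=> oO.
suff : open (quotient_map N @^-1` (quotient_map N @` O)) by [].
have -> : quotient_map N @^-1` (quotient_map N @` O) =
    \bigcup_(n in normal_set N) ((fun g => (g * n)%g) @^-1` O).
  apply/seteqP; split => [g [o Oo /quotient_map_eq og]|g [n Nn On]].
    exists (g^-1 * o)%g; last by rewrite /= mulVKg.
    by have := normalV og; rewrite invgM invgK.
  exists (g * n)%g => //; apply/quotient_map_eq.
  by rewrite invgM -mulgA mulVg mulg1; exact: normalV.
by apply: bigcup_open => n _; move/continuousP: (@mulr_cont n); exact.
Qed.

Lemma nbhs_quotient_map (A : set G) :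
  nbhs 1%g A -> nbhs (1%g : quotient_group N) (quotient_map N @` A).
Proof.
move=> nA; have : open_nbhs (1%g : quotient_group N) (quotient_map N @` A°).
  split; first by apply: quotient_map_open; exact: open_interior.
  by exists 1%g.
move=> /open_nbhs_nbhs; apply: filterS => _ [g Ag <-]; exists g => //.
exact: interior_subset Ag.
Qed.

End QuotientNeighborhoods.

(** * Frame bounds *)

Section IncreasingSums.
Variables (R : realType) (T : choiceType) (s : nat -> seq T) (a : T -> R).
Hypotheses (s_uniq : forall n, uniq (s n)) (a0 : forall x, 0 <= a x).
Hypothesis s_incr : forall n, exists t, s n.+1 = s n ++ t.
Let S := [set x | exists n, x \in s n].

Lemma increasing_mem m n x : (m <= n)%N -> x \in s m -> x \in s n.
Proof.
elim: n => [|n IH]; first by rewrite leqn0 => /eqP->.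
rewrite leq_eqVlt => /predU1P[->//|mn] xm.
by have [t ->] := s_incr n; rewrite mem_cat IH.
Qed.

Lemma increasing_countable : countable S.
Proof.
have -> : S = \bigcup_(n in setT) [set` s n].
  by apply/seteqP; split => [x [n xn]|x [n _ xn]]; exists n.
by apply: bigcup_countable => // n _; apply: finite_set_countable.
Qed.

Lemma esum_seq (t : seq T) : uniq t ->
  (\sum_(x \in [set` t]) (a x)%:E = (\sum_(x <- t) a x)%:E)%E.
Proof. by move=> ut; rewrite -fsbig_seq// sumEFin. Qed.

Lemma esum_increasing_ge n :
  ((\sum_(x <- s n) a x)%:E <= \esum_(x in S) (a x)%:E)%E.
Proof.
apply: esum_ge; exists [set` s n]; last by rewrite esum_seq.
by split => [|x xn]; [exact: finite_seq|exists n].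
Qed.

(** A finite subset of the union is contained in a single [s n]. *)
Lemma esum_increasing_le (b : R) : (forall n, \sum_(x <- s n) a x <= b) ->
  (\esum_(x in S) (a x)%:E <= b%:E)%E.
Proof.
move=> sb; apply: ereal.ge_ereal_sup => _ [F [Ffin FS] <-].
have [t Ft] := (finite_seqP F).1 Ffin; subst F.
have [n tn] : exists n, {subset t <= s n}.
  elim: t FS {Ffin} => [|x t IH] tS; first by exists 0%N.
  have [m xm] : S x by apply: tS; rewrite /= inE eqxx.
  have [|n tn] := IH; first by move=> y yt; apply: tS; rewrite /= inE yt orbT.
  exists (maxn m n) => y; rewrite inE => /predU1P[->|/tn yn].
    exact: increasing_mem (leq_maxl _ _) xm.
  exact: increasing_mem (leq_maxr _ _) yn.
apply: (@le_trans _ _ (\sum_(x \in [set` s n]) (a x)%:E)%E); last first.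
  by rewrite esum_seq// lee_fin.
apply: ereal.lee_fsum_nneg_subset => //; first by move=> x; rewrite !inE;
  exact: tn.
by move=> x _; rewrite lee_fin.
Qed.

End IncreasingSums.

Section FrameInequality.
Variable R : realType.

Lemma sqr_perturb (eps x y z : R) : 0 < eps -> 0 <= x -> x <= y + z ->
  x ^+ 2 <= (1 + eps) * y ^+ 2 + (1 + eps^-1) * z ^+ 2.
Proof.
move=> e0 x0 xyz; apply: (@le_trans _ _ ((y + z) ^+ 2)).
  by apply: lerXn2r; rewrite ?nnegrE// (le_trans x0).
have -> : (1 + eps) * y ^+ 2 + (1 + eps^-1) * z ^+ 2 =
    (y + z) ^+ 2 + eps^-1 * (eps * y - z) ^+ 2 by field; rewrite gt_eqF.
by rewrite lerDl mulr_ge0 ?sqr_ge0// invr_ge0 ltW.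
Qed.

Lemma sum_perturb (T : Type) (l : seq T) (eps E : R) (x y z : T -> R) :
  0 < eps -> (forall p, 0 <= x p) -> (forall p, x p <= y p + z p) ->
  \sum_(p <- l) z p ^+ 2 <= E ->
  \sum_(p <- l) x p ^+ 2 <=
    (1 + eps) * (\sum_(p <- l) y p ^+ 2) + (1 + eps^-1) * E.
Proof.
move=> e0 x0 xyz zE.
apply: (@le_trans _ _ (\sum_(p <- l) ((1 + eps) * y p ^+ 2 + (1 + eps^-1) * z p
  ^+ 2))).
  by apply: ler_sum => p _; exact: sqr_perturb.
rewrite big_split /= -!mulr_sumr lerD2l ler_wpM2l//.
by rewrite addr_ge0// invr_ge0 ltW.
Qed.

Variables (G : preTopologicalGroupType) (H : hilbertType R).
Variable rho : unitary_rep G H.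
Local Notation entry := (G * (H * H))%type.

Lemma frame_perturb (phi f : H) (l : seq entry) (eps eta : R) :
  0 < eps -> eta = eps / 6 ->
  \sum_(p <- l) rnorm (rest_part rho phi p) ^+ 2 <= 2 * eta ^+ 2 ->
  synthesis_bound (map (@stray_part _ _ H) l) (2 * eta ^+ 2) ->
  let A := \sum_(p <- l) rnorm (inner f (main_part p)) ^+ 2 in
  let S := \sum_(p <- l) rnorm (inner f (rho p.1 phi)) ^+ 2 in
  let E := (eps + eps ^+ 2) / 4 * rnorm f ^+ 2 in
  S <= (1 + eps) * A + E /\ A <= (1 + eps) * S + E.
Proof.
move=> e0 eta6 rest stray A S E.
pose z p := rnorm (inner f (rest_part rho phi p)) + rnorm (inner f (stray_part
  p)).
(* By [(u + v)^2 <= 2 u^2 + 2 v^2] the error is at most [8 * eta ^+ 2 = 2 / 9 * eps ^+ 2] times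
   [rnorm f ^+ 2]; the factor [1 + eps^-1] of [sum_perturb] turns [E0] into [E]. *)
pose E0 := eps ^+ 2 / 4 * rnorm f ^+ 2.
have f0 : 0 <= rnorm f ^+ 2 by rewrite sqr_ge0.
have zE : \sum_(p <- l) z p ^+ 2 <= E0.
  have bessel : \sum_(p <- l) rnorm (inner f (stray_part p)) ^+ 2 <=
      2 * eta ^+ 2 * rnorm f ^+ 2.
    have := synthesis_bessel f _ stray; rewrite /coef_energy big_map; apply.
    by rewrite mulr_ge0 ?sqr_ge0.
  have cs : \sum_(p <- l) rnorm (inner f (rest_part rho phi p)) ^+ 2 <=
      2 * eta ^+ 2 * rnorm f ^+ 2.
    apply: (@le_trans _ _ ((\sum_(p <- l) rnorm (rest_part rho phi p) ^+ 2) *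
      rnorm f ^+ 2)).
      rewrite mulr_suml; apply: ler_sum => p _; rewrite -exprMn mulrC.
      by apply: lerXn2r; rewrite ?nnegrE ?mulr_ge0 ?rnorm_ge0 ?cauchy_schwarz.
    by rewrite ler_wpM2r.
  apply: (@le_trans _ _ (\sum_(p <- l) (2 * rnorm (inner f (rest_part rho phi
    p)) ^+ 2 +
      2 * rnorm (inner f (stray_part p)) ^+ 2))).
    apply: ler_sum => p _; rewrite /z.
    have := sqr_ge0 (rnorm (inner f (rest_part rho phi p)) - rnorm (inner f
      (stray_part p))).
    by move: (rnorm _) (rnorm (inner f (stray_part p))) => u v;
      rewrite sqrrB sqrrD; lra.
  rewrite big_split /= -!mulr_sumr /E0; move: bessel cs; rewrite eta6.
  move: (\sum_(p <- l) _) (\sum_(p <- l) _) => u v.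
  have : (eps / 6) ^+ 2 = eps ^+ 2 / 36 by field.
  move=> ->; have : 0 <= eps ^+ 2 * rnorm f ^+ 2 by rewrite mulr_ge0 ?sqr_ge0.
  lra.
have EE : (1 + eps^-1) * E0 = E by rewrite /E0 /E; field; rewrite gt_eqF.
have split_rho p : inner f (rho p.1 phi) =
    inner f (main_part p) + (inner f (rest_part rho phi p) + inner f
      (stray_part p)).
  by rewrite /rest_part !innerBr; ring.
split; rewrite -EE; apply: (sum_perturb e0 _ _ zE) => p; rewrite ?rnorm_ge0//.
  rewrite split_rho; apply: le_trans (ler_rnormD _ _) _; rewrite lerD2l.
  exact: ler_rnormD.
have -> : inner f (main_part p) = inner f (rho p.1 phi) -
   (inner f (rest_part rho phi p) + inner f (stray_part p)).
  by rewrite split_rho addrK.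
apply: le_trans (ler_rnormD _ _) _; rewrite rnormN lerD2l.
exact: ler_rnormD.
Qed.

End FrameInequality.

Lemma pairwise_sym_in (T : eqType) (r : rel T) (s : seq T) x y :
  symmetric r -> pairwise r s -> x \in s -> y \in s -> x != y -> r x y.
Proof.
move=> rs; elim: s => [//|z s IH] /= /andP[/allP zs ps].
rewrite !inE => /predU1P[->|xs] /predU1P[->|ys] xy.
- by rewrite eqxx in xy.
- exact: zs.
- by rewrite rs zs.
exact: IH.
Qed.

(** * Separation of the orbit modulo the projective kernel *)

Section OrbitSeparation.
Variables (K : localFieldType) (d : nat) (R : realType) (H : hilbertType R).
Variable rho : unitary_rep (SL K d) H.
Hypothesis rho_cont : strongly_continuous rho.
Variables (psi : H) (Gam : set (SL K d)).
Hypothesis psi0 : psi != 0.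
Hypothesis sep : forall g h, Gam g -> Gam h -> g != h ->
  rnorm (inner (rho g psi) (rho h psi)) <= rnorm psi ^+ 2 / 2.
Local Notation q := (quotient_map (pker rho)).

Lemma separated_injective : {in Gam &, injective q}.
Proof.
move=> g h; rewrite !inE => Gg Gh qgh; apply/eqP/negPn/negP => gh.
have := sep Gg Gh gh; rewrite (same_coset_inner psi qgh (erefl (q h))).
rewrite innerxx urep_rnorm rnorm_real ger0_norm ?sqr_ge0//.
have : 0 < rnorm psi ^+ 2 by rewrite exprn_gt0 ?rnorm_gt0.
lra.
Qed.

Lemma separated_relatively : left_relatively_separated [set q g | g in Gam].
Proof.
have n0 : 0 < rnorm psi by rewrite rnorm_gt0.
have [C nC cC] := SL_locally_compact K d.
(* Two elements of one translate of [W] move [psi] to vectors at distance below [rnorm psi / 2],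
   whose inner product then exceeds [rnorm psi ^+ 2 / 2] in modulus; so each translate contains at
   most one point. *)
pose W := [set h : SL K d | rnorm (rho 1%g psi - rho h psi) < rnorm psi / 4].
have nW : nbhs 1%g W by apply: near_rep => //; rewrite divr_gt0.
exists (q @` (C `&` W)); split.
- apply: nbhs_quotient_map; last exact: filterI.
  exact: SL_mulr_continuous.
- apply: (@precompact_subset _ _ (q @` C)); first by move=> _ [c [Cc _] <-];
    exists c.
  rewrite precompact_closed; last exact: pker_saturation_closed.
  apply: continuous_compact => //; apply: continuous_subspaceT.
  exact: pi_continuous.
exists 1%N => x; set L := _ `&` _.
have L1 a b : L a -> L b -> a = b.
  have [x' xE] : exists x', q x' = x by eexists; exact: quotient_map_repr.
  move=> [[g Gg <-] [_ [w [_ Ww] <-] gw]] [[h Gh <-] [_ [u [_ Wu] <-] hu]].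
  have gw' : q g = q (x' * w)%g by rewrite -gw -xE; exact: quotient_mulE.
  have hu' : q h = q (x' * u)%g by rewrite -hu -xE; exact: quotient_mulE.
  congr q; apply/eqP/negPn/negP => gh.
  have := sep Gg Gh gh; rewrite (same_coset_inner psi gw' hu') !urepM urep_inner.
  move: Ww Wu; rewrite /W /= urep1 => Ww Wu.
  have near_wu : rnorm (rho w psi - rho u psi) < rnorm psi / 2.
    rewrite -(subrKA psi); apply: le_lt_trans (ler_rnormD _ _) _.
    by rewrite rdistrC; lra.
  have cs := cauchy_schwarz (rho u psi - rho w psi) (rho u psi).
  have := ler_rnormB (inner (rho u psi) (rho u psi)) (inner (rho u psi - rho w
    psi) (rho u psi)).
  rewrite -innerBl subKr innerxx urep_rnorm rnorm_real ger0_norm ?sqr_ge0//.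
  move: cs; rewrite urep_rnorm (rdistrC (rho u psi)).
  have : rnorm (rho w psi - rho u psi) * rnorm psi < rnorm psi ^+ 2 / 2.
    by rewrite expr2 mulrAC ltr_pM2r.
  lra.
have [[a La]|L0] := pselect (exists a, L a).
  have -> : L = [set a] by apply/seteqP; split => [b Lb|_ ->//]; exact: L1.
  by rewrite (card_le_eql card_set1).
have -> : L = set0 by apply/seteqP; split => // a La; case: L0; exists a.
exact: card_ge0.
Qed.

End OrbitSeparation.

Local Close Scope complex_scope.

Theorem theorem1p3 (K : localFieldType) (d : nat) (R : realType)
    (H : hilbertType R) (rho : unitary_rep (SL K d) H) (eps : R) :
  (2 <= d)%N ->
  separable H ->
  infinite_dimensional H ->
  irreducible rho ->
  strongly_continuous rho ->
  0 < eps < 1 ->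
  exists (phi : H) (Gamma : set (SL K d)),
    [/\ phi != 0,
        countable Gamma,
        (forall f : H,
          (((1 - eps) ^+ 2 * rnorm f ^+ 2)%:E
             <= \esum_(g in Gamma) (rnorm (inner f (rho g phi)) ^+ 2)%:E)%E /\
          (\esum_(g in Gamma) (rnorm (inner f (rho g phi)) ^+ 2)%:E
             <= ((1 + eps) ^+ 2 * rnorm f ^+ 2)%:E)%E),
        {in Gamma &, injective (@quotient_map (SL K d) (pker rho))}
      & left_relatively_separated
          [set quotient_map (pker rho) g | g in Gamma]].
Proof.
move=> d2 sepH infH irr rho_cont /andP[eps0 eps1].
have [psi psi0] := irr.1.
have [e [e1 bessel parseval]] := parseval_system sepH.
have spread : spreading rho.
  by move=> v X m x x0; exact: orbit_block.
pose eta := eps / 6; have eta0 : 0 < eta by rewrite divr_gt0.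
have [phi [L [L_incr main rest stray sep]]] := orbit_limit spread psi0 eta0 e1.
pose s n := [seq p.1 | p <- L n].
pose Gam := [set g | exists n, g \in s n].
have psep n : pairwise (fun g h => rnorm (inner (rho g psi) (rho h psi)) <=
    rnorm psi ^+ 2 / 2) (s n) by rewrite pairwise_map; exact: sep.
have psi_gt0 : 0 < rnorm psi ^+ 2 by rewrite exprn_gt0 ?rnorm_gt0.
(* A repeated element would violate separation against itself. Sums over the list are thus sums over
   a set. *)
have s_uniq n : uniq (s n).
  rewrite uniq_pairwise; apply: sub_pairwise (psep n) => g h gh.
  apply/negP => /eqP ghE; move: gh; rewrite ghE innerxx urep_rnorm rnorm_real.
  by rewrite ger0_norm ?sqr_ge0//; lra.
have s_incr n : exists t, s n.+1 = s n ++ t.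
  by have [blk Lblk] := L_incr n; exists [seq p.1 | p <- blk];
    rewrite /s Lblk map_cat.
have gam_sep g h : Gam g -> Gam h -> g != h ->
    rnorm (inner (rho g psi) (rho h psi)) <= rnorm psi ^+ 2 / 2.
  move=> [m gm] [n hn]; apply: (pairwise_sym_in _ (psep (maxn m n))).
  - by move=> a b /=; rewrite rnorm_innerC.
  - exact: increasing_mem s_incr _ _ _ (leq_maxl m n) gm.
  - exact: increasing_mem s_incr _ _ _ (leq_maxr m n) hn.
have frame f n := frame_perturb f eps0 (erefl eta) (rest n) (stray n).
have bounds (f : H) :
    (((1 - eps) ^+ 2 * rnorm f ^+ 2)%:E
       <= \esum_(g in Gam) (rnorm (inner f (rho g phi)) ^+ 2)%:E)%E /\
    (\esum_(g in Gam) (rnorm (inner f (rho g phi)) ^+ 2)%:E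
       <= ((1 + eps) ^+ 2 * rnorm f ^+ 2)%:E)%E.
  have a0 g : 0 <= rnorm (inner f (rho g phi)) ^+ 2 by rewrite sqr_ge0.
  have f0 : 0 <= rnorm f ^+ 2 by rewrite sqr_ge0.
  split.
    have [->|fn0] := eqVneq f 0.
      by rewrite rnorm0 expr0n mulr0; apply: esum_ge0 => g _;
        rewrite lee_fin sqr_ge0.
    have fp : 0 < rnorm f ^+ 2 by rewrite exprn_gt0 ?rnorm_gt0.
    (* Together with the error [(eps + eps ^+ 2) / 4] this loss is exactly [eps / 2], and
       [1 - eps / 2] exceeds [(1 + eps) * (1 - eps) ^+ 2]. *)
    have gap0 : 0 < eps / 4 * (1 - eps) by rewrite mulr_gt0 ?divr_gt0 ?subr_gt0.
    have [n An] := parseval f (eps / 4 * (1 - eps) * rnorm f ^+ 2) (mulr_gt0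
      gap0 fp).
    apply: (@le_trans _ _ (\sum_(g <- s n) rnorm (inner f (rho g phi)) ^+
      2)%:E); last first.
      exact: esum_increasing_ge.
    rewrite lee_fin big_map -(@ler_pM2l _ (1 + eps)) ?addr_gt0//.
    have [_] := frame f n; rewrite main.
    move: (\sum_(p <- L n) _) (coef_energy _ f) (rnorm f ^+ 2) fp An => S A F
      Fp AF AS.
    have : (1 + eps) * ((1 - eps) ^+ 2 * F) + eps / 4 * (1 - eps) * F +
        (eps + eps ^+ 2) / 4 * F <= F.
      rewrite -subr_ge0 (_ : _ - _ = F * (eps / 2 + eps ^+ 2 * (1 - eps)));
        last by field.
      apply: mulr_ge0; first exact: ltW.
      apply: addr_ge0; first by rewrite divr_ge0// ltW.
      by rewrite mulr_ge0 ?sqr_ge0// subr_ge0 ltW.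
    lra.
  apply: esum_increasing_le => // n; rewrite big_map.
  have [+ _] := frame f n; rewrite main; have := bessel f n.
  move: (coef_energy _ f) (rnorm f ^+ 2) f0 => A F F0 AF SA.
  (* The total factor is [(1 + eps) * (1 + eps / 4)]. *)
  apply: le_trans SA _; nra.
exists phi, Gam; split => //.
- apply/eqP => phi0; have [+ _] := bounds psi; rewrite phi0.
  rewrite esum1 => [|g _]; last by rewrite urep0 inner0r rnorm0 expr0n.
  by rewrite lee_fin leNgt mulr_gt0// exprn_gt0// subr_gt0.
- exact: increasing_countable.
- exact: separated_injective psi0 gam_sep.
have := separated_relatively rho_cont psi0 gam_sep; exact.
Qed.
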